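(* Let $W\ge 0$ be an even weight function belonging to the Szegő weight class $G$, and let $\{\phi_j\}_{j\ge 0}$ be the orthogonal polynomials on the unit circle associated to $W$. For each integer $n\ge 0$ let $$P_n(z)=\sum_{j=0}^n\eta_j\phi_j(z),\qquad \eta_j=\alpha_j+i\beta_j,$$ where $\alpha_0,\dots,\alpha_n,\beta_0,\dots,\beta_n$ are independent real standard normal random variables, and let $h_n^P$ be the intensity function of the zeros of $P_n$. Then for every $z\in\mathbb{C}$ with $|z|\neq 1$, $$\lim_{n\to\infty}h_n^P(z)=\frac{1}{\pi\left(1-|z|^2\right)^2}.$$ Moreover, this convergence holds uniformly on compact subsets of $\{z\in\mathbb{C}:|z|\neq 1\}$.
   Context: Szegő weight class $G$: a function $W(\theta)\ge 0$ belongs to $G$ if $W$ is defined and measurable on $[-\pi,\pi]$ and the integrals $\int_{-\pi}^{\pi}W(\theta)\,d\theta$ and $\int_{-\pi}^{\pi}|\log W(\theta)|\,d\theta$ exist (are finite), with the first integral positive. Weights are regarded as $2\pi$-periodic functions; $W$ is even if $W(-\theta)=W(\theta)$. Orthogonal polynomials on the unit circle (OPUC) associated to a weight $W$: the unique polynomials $\phi_0,\phi_1,\phi_2,\dots$ such that $\phi_m$ has exact degree $m$ with real positive leading coefficient and $$\frac{1}{2\pi}\int_{-\pi}^{\pi}W(\theta)\,\phi_m(e^{i\theta})\,\overline{\phi_k(e^{i\theta})}\,d\theta=\delta_{mk}\qquad\text{for all } m,k\in\mathbb{N}\cup\{0\}.$$ When $W$ is even, all the $\phi_j$ have real coefficients.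 Intensity function: for a Jordan region $\Omega\subset\mathbb{C}$ (the interior of a Jordan curve), $N_n(\Omega)$ denotes the random number of zeros of $P_n$ in $\Omega$, and $\mathbb{E}$ denotes expectation. The intensity function $h_n^P$ is the density for the expected number of zeros, i.e. $\mathbb{E}[N_n(\Omega)]=\int_\Omega h_n^P(x+iy)\,dx\,dy$ for every Jordan region $\Omega$. By a previously known result, this density is given (and its pointwise values are understood to be given) by $$h_n^P(z)=\frac{K_n^{(1,1)}(z,z)\,K_n(z,z)-\left|K_n^{(0,1)}(z,z)\right|^2}{\pi\,\left(K_n(z,z)\right)^2},$$ where $K_n(z,w)=\sum_{j=0}^n\phi_j(z)\overline{\phi_j(w)}$, $K_n^{(0,1)}(z,w)=\sum_{j=0}^n\phi_j(z)\overline{\phi_j'(w)}$, and $K_n^{(1,1)}(z,w)=\sum_{j=0}^n\phi_j'(z)\overline{\phi_j'(w)}$. (Here $K_n(z,z)\ge|\phi_0|^2>0$ for every $z$.) *)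

(* Defs.v *)
From HB Require Import structures.
From mathcomp Require Import all_boot all_order all_algebra.
From mathcomp Require Import complex.
From mathcomp Require Import all_classical all_reals all_analysis.

Set Implicit Arguments.
Unset Strict Implicit.
Unset Printing Implicit Defensive.

Import Order.TTheory GRing.Theory Num.Theory.
Import numFieldNormedType.Exports.

Local Open Scope classical_set_scope.
Local Open Scope ring_scope.
Local Open Scope complex_scope.

(* [R[i]] carries the topology of the complex modulus, as any [numFieldType];
   the library's generic instance is not found by unification on [R[i]]. *)
HB.instance Definition _ (R : realType) :=
  PseudoPointedMetric.copy R[i] (R[i])^o.
HB.instance Definition _ (R : realType) := NormedModule.copy R[i] (R[i])^o.

(* [lne] is the extended logarithm, with [lne 0 = -oo]; the real-valued [ln]
   of the library has [ln 0 = 0] and would allow [W] to vanish on a set of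
   positive measure. *)
Definition szego_class (R : realType) (W : R -> R) : Prop :=
  [/\ (forall t, t \in `[- pi, pi] -> 0 <= W t),
      measurable_fun `[- pi, pi] W,
      (0 < \int[lebesgue_measure]_(t in `[(- pi)%R, pi]) (W t)%:E < +oo)%E &
      (\int[lebesgue_measure]_(t in `[(- pi)%R, pi]) `|lne (W t)%:E| < +oo)%E].

Definition expi (R : realType) (t : R) : R[i] := cos t +i* sin t.

Definition Cintegral (R : realType) (D : set R) (f : R -> R[i]) : R[i] :=
  (\int[lebesgue_measure]_(t in D) complex.Re (f t))
  +i* (\int[lebesgue_measure]_(t in D) complex.Im (f t)).

(* In [R[i]], [0 < c] means that [c] is real and positive. *)
Definition is_OPUC (R : realType) (W : R -> R) (phi : nat -> {poly R[i]}) :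
    Prop :=
  (forall m, size (phi m) = m.+1 /\ 0 < lead_coef (phi m)) /\
  (forall m k,
    ((2 * pi)^-1)%:C *
      Cintegral `[- pi, pi]
        (fun t => (W t)%:C * (phi m).[expi t] * ((phi k).[expi t])^*)
    = (m == k)%:R).

Section Kernels.
Variables (R : realType) (phi : nat -> {poly R[i]}).

Definition K00 n (z w : R[i]) : R[i] :=
  \sum_(j < n.+1) (phi j).[z] * ((phi j).[w])^*.

Definition K01 n (z w : R[i]) : R[i] :=
  \sum_(j < n.+1) (phi j).[z] * (((phi j)^`()).[w])^*.

Definition K11 n (z w : R[i]) : R[i] :=
  \sum_(j < n.+1) ((phi j)^`()).[z] * (((phi j)^`()).[w])^*.

End Kernels.

(* Some of the sets [A i] may be the whole line, so that the product rule for
   all of [I] contains the product rule for every subfamily. *)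
Definition mutually_independent d (T : measurableType d) (R : realType)
    (P : probability T R) (I : finType) (X : I -> {RV P >-> R}) : Prop :=
  forall A : I -> set R, (forall i, measurable (A i)) ->
    P (\bigcap_(i in [set: I]) X i @^-1` A i) =
    (\prod_(i : I) P (X i @^-1` A i))%E.

Definition standard_normal d (T : measurableType d) (R : realType)
    (P : probability T R) (X : {RV P >-> R}) : Prop :=
  forall A : set R, measurable A -> distribution P X A = normal_prob 0 1 A.

Definition iid_standard_normal d (T : measurableType d) (R : realType)
    (P : probability T R) (alpha beta : nat -> {RV P >-> R}) : Prop :=
  (forall j, standard_normal (alpha j) /\ standard_normal (beta j)) /\
  (forall n, mutually_independent
    (fun i : 'I_n.+1 + 'I_n.+1 =>
       match i with inl j => alpha j | inr j => beta j end)).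

Definition random_poly d (T : measurableType d) (R : realType)
    (P : probability T R) (alpha beta : nat -> {RV P >-> R})
    (phi : nat -> {poly R[i]}) (n : nat) (omega : T) : {poly R[i]} :=
  \sum_(j < n.+1) (alpha j omega +i* beta j omega) *: phi j.

(* Zeros are counted with multiplicity.  The value is meaningless for the zero
   polynomial, which [random_poly] takes with probability zero only. *)
Definition num_zeros (R : realType) (p : {poly R[i]}) (Omega : set R[i]) :
    \bar R :=
  \esum_(z in Omega `&` [set z | root p z]) ((mup z p)%:R)%:E.

Definition is_jordan_curve (R : realType) (gamma : R -> R[i]) : Prop :=
  [/\ {within `[0, 1], continuous gamma}, gamma 0 = gamma 1 &
      {in `[0, 1[ &, injective gamma}].

(* The interior of a Jordan curve is the bounded component of its
   complement. *)
Definition jordan_region (R : realType) (Omega : set R[i]) : Prop :=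
  exists gamma : R -> R[i],
    [/\ is_jordan_curve gamma,
        (exists2 z, (~` (gamma @` `[0, 1])) z &
           Omega = connected_component (~` (gamma @` `[0, 1])) z) &
        exists M : R, forall z, Omega z -> `|z| <= M%:C].

(* A density is determined by the expected numbers of zeros only almost
   everywhere; the second clause fixes its value at every point, as given by
   the Kac-Rice formula. *)
Definition is_intensity d (T : measurableType d) (R : realType)
    (P : probability T R) (alpha beta : nat -> {RV P >-> R})
    (phi : nat -> {poly R[i]}) (n : nat) (h : R[i] -> R) : Prop :=
  (forall Omega, jordan_region Omega ->
    (\int[P]_omega num_zeros (random_poly alpha beta phi n omega) Omega =
     \int[lebesgue_measure \x lebesgue_measure]_(
         u in [set u : R * R | Omega (u.1 +i* u.2)])
       (h (u.1 +i* u.2))%:E)%E) /\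
  (forall z : R[i],
    (h z)%:C = (K11 phi n z z * K00 phi n z z - `|K01 phi n z z| ^+ 2)
               / (pi%:C * K00 phi n z z ^+ 2)).

Definition limit_intensity (R : realType) (z : R[i]) : R :=
  1 / (pi * (1 - (ComplexField.Normc.normc z) ^+ 2) ^+ 2).

(* Main.v *)
Require Import Defs.
From HB Require Import structures.
From mathcomp Require Import all_boot all_order all_algebra.
From mathcomp Require Import complex ring lra.
From mathcomp Require Import all_classical all_reals all_analysis.
From mathcomp Require Import measurable_realfun.

Set Implicit Arguments.
Unset Strict Implicit.
Unset Printing Implicit Defensive.

Import Order.TTheory GRing.Theory Num.Theory.
Import numFieldNormedType.Exports.

(* The proof uses only the Kac-Rice formula.  Write [u = phi_{n+1}(z)] and
   [v = phi*_{n+1}(z)], where [phi*] is the reversed polynomial, and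
   [D = 1 - |z|^2].  The Christoffel-Darboux formula
   [D K_n(z,z) = |v|^2 - |u|^2] and its derivatives turn the formula into
     [pi h_n = 1 / D^2 - |u' v - u v'|^2 / (|v|^2 - |u|^2)^2].
   The last term is [|b'|^2 / (1 - |b|^2)^2] for [b = u / v] when [|z| < 1] and
   for [b = v / u] when [|z| > 1], so it suffices that [b] and [b'] tend to 0
   uniformly when [|z| <= r] or [|z| >= 1 / r].  By the Szego recursion, [b]
   evolves under Moebius maps whose parameters [c_n] satisfy
   [|c_n|^2 = 1 - (kappa_n / kappa_{n+1})^2], where [kappa_n] is the leading
   coefficient of [phi_n]; as soon as [c_n] tends to 0 they contract by a factor
   tending to [r].  Finally [kappa_n] is nondecreasing, and it is bounded:
   integrating [W |phi_n|^2 >= 1 + ln W + ln |phi_n|^2] over the circle gives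
   [ln (kappa_n^2) <= - (mean of ln W)], since the roots of [phi_n] lie in the
   unit disk. *)

Local Open Scope ring_scope.

(** * Orthogonal polynomials of a Toeplitz form *)

(* [z^n conj(p(1 / conj z))], provided that [size p <= n.+1]. *)
Definition reversed (C : numClosedFieldType) n (p : {poly C}) : {poly C} :=
  \poly_(i < n.+1) (p`_(n - i))^*.

Section Reversed.
Variable C : numClosedFieldType.
Implicit Types (p q : {poly C}) (n : nat) (a : C).

Lemma size_reversed n p : (size (reversed n p) <= n.+1)%N.
Proof. exact: size_poly. Qed.

Lemma reversedK n p : (size p <= n.+1)%N -> reversed n (reversed n p) = p.
Proof.
move=> sp; apply/polyP => i; rewrite !coef_poly.
case: ltnP => [ltin|lein]; last by rewrite nth_default // (leq_trans sp).
by rewrite ltnS leq_subr conjCK subKn.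
Qed.

Lemma reversedD n p q : reversed n (p + q) = reversed n p + reversed n q.
Proof.
apply/polyP => i; rewrite coefD !coef_poly.
by case: ifP => _; rewrite ?addr0 // coefD rmorphD.
Qed.

Lemma reversedZ n a p : reversed n (a *: p) = a^* *: reversed n p.
Proof.
apply/polyP => i; rewrite coefZ !coef_poly.
by case: ifP => _; rewrite ?mulr0 // coefZ rmorphM.
Qed.

Lemma reversedB n p q : reversed n (p - q) = reversed n p - reversed n q.
Proof. by rewrite reversedD -scaleN1r reversedZ rmorphN1 scaleN1r. Qed.

Lemma reversed_mulX n p : reversed n.+1 ('X * p) = reversed n p.
Proof.
apply/polyP => i; rewrite !coef_poly coefXM !ltnS.
case: (leqP i n) => [lein|ltni].
  by rewrite leqW // subSn.
case: ifP => // _; suff -> : (n.+1 - i = 0)%N by rewrite conjC0.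
by apply/eqP; rewrite subn_eq0.
Qed.


Lemma reversedS n p :
  (size p <= n.+1)%N -> reversed n.+1 p = 'X * reversed n p.
Proof.
move=> sp; rewrite -{1}[p](reversedK sp) -(reversed_mulX n (reversed n p)) reversedK //.
by rewrite (leq_trans (size_polyMleq _ _)) // size_polyX /= ltnS size_reversed.
Qed.

(** On the unit circle [z^*] is [z^-1], so reflecting the exponents amounts to conjugating the value
    and multiplying by [z ^+ n]. *)
Lemma horner_reversed n p z : (size p <= n.+1)%N -> `|z| = 1 ->
  (reversed n p).[z] = z ^+ n * (p.[z])^*.
Proof.
move=> sp z1; rewrite horner_poly (horner_coef_wide _ sp) rmorph_sum mulr_sumr.
rewrite (reindex_inj rev_ord_inj) /=; apply: eq_bigr => i _.
have lein : (i <= n)%N by rewrite -ltnS.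
rewrite subSS subKn // rmorphM rmorphXn /= mulrCA; congr (_ * _).
have z0 : z != 0 by rewrite -normr_eq0 z1 oner_eq0.
have -> : z^* = z^-1 by apply: (mulfI z0); rewrite -normCK z1 divff // expr1n.
by rewrite exprVn -expfB_cond // (negbTE z0).
Qed.

End Reversed.

Section Form.
Variable C : numClosedFieldType.
Implicit Types (p q r : {poly C}) (n : nat) (a c : C).

(** What the recursion takes from the weighted inner product; the last two fields reflect
    integration over the unit circle. Positivity comes from an orthonormal family, in [form_gt0]. *)
Record toeplitz_form (B : {poly C} -> {poly C} -> C) : Prop := ToeplitzForm {
  form_linear : forall a p q r, B (a *: p + q) r = a * B p r + B q r;
  form_sym : forall p q, B q p = (B p q)^*;
  form_mulX : forall p q, B ('X * p) ('X * q) = B p q;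
  form_reversed : forall n p q, (size p <= n.+1)%N -> (size q <= n.+1)%N ->
    B (reversed n p) (reversed n q) = B q p }.

Variable B : {poly C} -> {poly C} -> C.
Hypothesis B_form : toeplitz_form B.

Lemma form0 r : B 0 r = 0.
Proof.
have := form_linear B_form (-1) 0 0 r.
by rewrite scaler0 addr0 mulN1r addNr.
Qed.

Lemma formZ a p r : B (a *: p) r = a * B p r.
Proof. by rewrite -[a *: p]addr0 (form_linear B_form) form0 addr0. Qed.

Lemma formD p q r : B (p + q) r = B p r + B q r.
Proof. by rewrite -[p]scale1r (form_linear B_form) scale1r mul1r. Qed.

Lemma formB p q r : B (p - q) r = B p r - B q r.
Proof. by rewrite formD -scaleN1r formZ mulN1r. Qed.

Lemma formDr p q r : B r (p + q) = B r p + B r q.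
Proof. by rewrite !(form_sym B_form _ r) formD rmorphD. Qed.

Lemma formZr a p r : B r (a *: p) = a^* * B r p.
Proof. by rewrite !(form_sym B_form _ r) formZ rmorphM. Qed.

Lemma form_suml (I : Type) (s : seq I) (F : I -> {poly C}) r :
  B (\sum_(i <- s) F i) r = \sum_(i <- s) B (F i) r.
Proof. by apply: (big_morph (B^~ r)) => [p q|]; rewrite ?formD ?form0. Qed.

Lemma form_orthog_sym p q : B p q = 0 -> B q p = 0.
Proof. by move=> pq; rewrite (form_sym B_form) pq conjC0. Qed.

Variable phi : nat -> {poly C}.
Hypothesis size_phi : forall m, size (phi m) = m.+1.
Hypothesis lead_phi : forall m, 0 < lead_coef (phi m).
Hypothesis B_phi : forall m k, B (phi m) (phi k) = (m == k)%:R.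

Lemma phi_span n p : (size p <= n)%N ->
  exists c : nat -> C, p = \sum_(j < n) c j *: phi j.
Proof.
elim: n p => [|n IH] p sp.
  by exists (fun=> 0); rewrite big_ord0; apply/eqP; rewrite -size_poly_leq0.
pose a := p`_n / lead_coef (phi n).
have [|c pE] := IH (p - a *: phi n).
  apply/leq_sizeP => j; rewrite leq_eqVlt => /orP[/eqP <-|ltnj].
    by rewrite coefB coefZ /a lead_coefE size_phi /= divfK ?subrr //
      -[X in _`_X]/(n.+1.-1) -size_phi -lead_coefE gt_eqF.
  rewrite coefB coefZ !nth_default ?mulr0 ?subrr ?size_phi //.
  exact: leq_trans sp _.
exists (fun j => if j == n then a else c j).
rewrite big_ord_recr /= eqxx -[LHS](subrK (a *: phi n)) {1}pE; congr (_ + _).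
by apply: eq_bigr => i _; rewrite ltn_eqF.
Qed.

Lemma form_low n p : (size p <= n)%N -> B p (phi n) = 0.
Proof.
move=> /phi_span[c ->]; rewrite form_suml big1 // => i _.
by rewrite formZ B_phi ltn_eqF // mulr0.
Qed.

(** Parseval: in the basis [phi], [B p p] is the sum of the [|c j|^2]. *)
Lemma form_gt0 p : p != 0 -> 0 < B p p.
Proof.
move=> p0; have [c pE] := phi_span (leqnn (size p)).
have Bj j : (j < size p)%N -> B p (phi j) = c j.
  move=> ltj; rewrite {1}pE form_suml (bigD1 (Ordinal ltj)) //= formZ B_phi.
  rewrite eqxx mulr1 big1 ?addr0 // => i; rewrite -val_eqE /= => nij.
  by rewrite formZ B_phi (negbTE nij) mulr0.
have Bpp : B p p = \sum_(j < size p) `|c j| ^+ 2.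
  rewrite {1}pE form_suml; apply: eq_bigr => i _.
  by rewrite formZ (form_sym B_form) Bj // normCK.
rewrite lt_neqAle Bpp sumr_ge0 ?andbT => [|i _]; last by rewrite exprn_ge0.
apply: contra p0; rewrite eq_sym psumr_eq0 => [/allP c0|i _]; last first.
  by rewrite exprn_ge0.
rewrite pE big1 // => i _.
have := c0 i; rewrite mem_index_enum expf_eq0 normr_eq0 => /(_ isT)/eqP ->.
by rewrite scale0r.
Qed.

(** The remainder after projecting on [phi n] is orthogonal to every [phi j] with [j <= n], hence to
    itself, so [form_gt0] forces it to vanish. *)
Lemma form_highest n p : (size p <= n.+1)%N ->
  (forall q, (size q <= n)%N -> B p q = 0) -> p = B p (phi n) *: phi n.
Proof.
move=> sp p_orth; apply/eqP; rewrite -subr_eq0; apply: contraT => r0.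
set r := p - _ in r0.
have r_phi : B r (phi n) = 0 by rewrite formB formZ B_phi eqxx mulr1 subrr.
have sr : (size r <= n.+1)%N.
  rewrite (leq_trans (size_polyD _ _)) // geq_max sp size_polyN.
  by rewrite (leq_trans (size_scale_leq _ _)) ?size_phi.
have [c rE] := phi_span sr.
have := form_gt0 r0; rewrite {2}rE; rewrite (form_sym B_form) form_suml.
rewrite big1 ?conjC0 ?ltxx // => i _.
rewrite formZ (form_sym B_form).
have := ltn_ord i; rewrite ltnS leq_eqVlt => /orP[/eqP ->|ltin].
  by rewrite r_phi conjC0 mulr0.
rewrite formB formZ p_orth ?size_phi // B_phi gtn_eqF // mulr0 subrr.
by rewrite conjC0 mulr0.
Qed.

Lemma size_mulX_leq n p : (size p <= n)%N -> (size ('X * p)%R <= n.+1)%N.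
Proof.
by move=> sp; rewrite (leq_trans (size_polyMleq _ _)) // size_polyX.
Qed.

(** ['X * phi n - s *: phi n.+1] has no term of degree [n.+1] and is orthogonal to ['X * q] for [q]
    of degree below [n]. Its reversal is thus orthogonal to all degrees below [n], hence a multiple
    of [phi n]; reversing back gives the recursion. *)
Lemma szego_recursion n :
  let s := lead_coef (phi n) / lead_coef (phi n.+1) in
  exists c, [/\ s ^+ 2 + `|c| ^+ 2 = 1,
    s *: phi n.+1 = 'X * phi n - c *: reversed n (phi n) &
    s *: reversed n.+1 (phi n.+1) = reversed n (phi n) - c^* *: ('X * phi n)].
Proof.
move=> s; have s_gt0 : 0 < s by rewrite divr_gt0.
have sC : s^* = s by apply/CrealP; rewrite gtr0_real.
pose p := 'X * phi n - s *: phi n.+1.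
have sXphi : size ('X * phi n) = n.+2.
  by rewrite mulrC size_mulX ?size_phi // -size_poly_gt0 size_phi.
have sp : (size p <= n.+1)%N.
  apply/leq_sizeP => j; rewrite leq_eqVlt => /orP[/eqP <-|ltnj].
    rewrite coefB coefZ coefXM /=.
    have -> : (phi n)`_n = lead_coef (phi n) by rewrite lead_coefE size_phi.
    have -> : (phi n.+1)`_n.+1 = lead_coef (phi n.+1).
      by rewrite lead_coefE size_phi.
    by rewrite divfK ?subrr // gt_eqF.
  by rewrite coefB coefZ !nth_default ?mulr0 ?subrr ?size_phi ?sXphi.
have p_orth q : (size q <= n)%N -> B p ('X * q) = 0.
  move=> sq; rewrite formB (form_mulX B_form) formZ.
  by rewrite !(form_orthog_sym (form_low _)) ?mulr0 ?subrr // size_mulX_leq.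
have [b rpE] : exists b, reversed n p = b *: phi n.
  exists (B (reversed n p) (phi n)); apply: form_highest => [|q sq].
    exact: size_reversed.
  have sq' : (size q <= n.+1)%N by rewrite leqW.
  rewrite -[q](reversedK sq') (form_reversed B_form) ?size_reversed //.
  apply: form_orthog_sym.
  (* Reversing at degree [n] a polynomial of smaller degree produces the factor ['X] that [p_orth]
     requires; for [n = 0] the polynomial is zero. *)
  case: n q sq sq' {s s_gt0 sC sXphi} p sp p_orth => [|n] q sq sq' p sp p_orth.
    move: sq; rewrite size_poly_leq0 => /eqP ->.
    have -> : reversed 0 (0 : {poly C}) = 0.
      by apply/polyP => i; rewrite coef_poly !coef0 conjC0 if_same.
    by rewrite (form_sym B_form) form0 conjC0.
  by rewrite reversedS // p_orth ?size_reversed.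
have pE : p = b^* *: reversed n (phi n) by rewrite -reversedZ -rpE reversedK.
have rec : s *: phi n.+1 = 'X * phi n - b^* *: reversed n (phi n).
  by rewrite -pE /p opprB addrC subrK.
exists b^*; split => //.
  (* Pythagoras: ['X * phi n] has norm 1 and is the sum of the orthogonal vectors [s *: phi n.+1]
     and [b^* *: reversed n (phi n)]. *)
  have revn : (size (reversed n (phi n)) <= n.+1)%N := size_reversed _ _.
  have <- : B ('X * phi n) ('X * phi n) = 1.
    by rewrite (form_mulX B_form) B_phi eqxx.
  have -> : 'X * phi n = s *: phi n.+1 + b^* *: reversed n (phi n).
    by rewrite rec subrK.
  rewrite formD !formDr !formZ !formZr B_phi eqxx mulr1 sC.
  rewrite (form_reversed B_form) ?size_phi // B_phi eqxx mulr1.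
  rewrite (form_low revn) (form_orthog_sym (form_low revn)).
  by rewrite !mulr0 addr0 add0r normCK expr2.
have /(congr1 (reversed n.+1)) := rec.
rewrite reversedZ sC reversedB reversed_mulX reversedZ conjCK => ->.
by rewrite reversedS ?size_reversed // reversedK ?size_phi.
Qed.

(* If [phi n = ('X - a) p], the terms of ['X * p = phi n + a p] are orthogonal,
   so [(1 - |a|^2) B p p = B (phi n) (phi n) = 1]. *)
Lemma phi_root_lt1 n a : root (phi n) a -> `|a| < 1.
Proof.
move=> /factor_theorem[p phiE].
have phi0 : phi n != 0 by rewrite -size_poly_gt0 size_phi.
have p0 : p != 0 by apply: contraNneq phi0 => p0; rewrite phiE p0 mul0r.
have sp : (size p <= n)%N.
  have := size_phi n.
  by rewrite phiE size_Mmonic ?monicXsubC // size_XsubC addn2 => -[->].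
have XpE : 'X * p = phi n + a *: p.
  by rewrite phiE mulrBr [p * a%:P]mulrC mul_polyC subrK mulrC.
have := form_mulX B_form p p; rewrite XpE formD !formDr !formZ !formZr B_phi eqxx.
rewrite (form_low sp) (form_orthog_sym (form_low sp)) !mulr0 addr0 add0r mulrA.
rewrite -normCK => Bpp.
have /(congr1 (fun x => x - `|a| ^+ 2 * B p p)) := Bpp.
rewrite addrK -{1}[B p p]mul1r -mulrBl => n1.
have : 0 < (1 - `|a| ^+ 2) * B p p by rewrite -n1 ltr01.
rewrite pmulr_lgt0 ?form_gt0 // subr_gt0.
by rewrite expr_lt1.
Qed.

End Form.

(** * Christoffel-Darboux identities at a point *)

Section KernelPoint.
Variable C : numClosedFieldType.
Variables (z : C) (s c u v u' v' : nat -> C).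
Hypothesis s_gt0 : forall n, 0 < s n.
Hypothesis s_c : forall n, s n ^+ 2 + `|c n| ^+ 2 = 1.
Hypothesis uE : forall n, s n * u n.+1 = z * u n - c n * v n.
Hypothesis vE : forall n, s n * v n.+1 = v n - (c n)^* * (z * u n).
Hypothesis u'E : forall n, s n * u' n.+1 = u n + z * u' n - c n * v' n.
Hypothesis v'E : forall n, s n * v' n.+1 = v' n - (c n)^* * (u n + z * u' n).
Hypothesis uv0 : v 0 = u 0.
Hypothesis u'0 : u' 0 = 0.
Hypothesis v'0 : v' 0 = 0.

Let s_neq0 n : s n != 0. Proof. by rewrite gt_eqF. Qed.
Let s_conj n : (s n)^* = s n. Proof. by apply/CrealP; rewrite gtr0_real. Qed.
Let s_sqr n : s n ^+ 2 = 1 - c n * (c n)^*.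
Proof. by rewrite -normCK -(s_c n) addrK. Qed.

(** In this section [u], [v], [u'], [v'] stand for the values at [z] of [phi n], its reversal and
    their derivatives. Since [s n ^+ 2 = 1 - |c n|^2], the matrix of one step lies in U(1,1) and
    preserves the form of signature (1,1). *)
Lemma lorentz_invariance n a b a1 b1 x y x1 y1 :
  s n * a1 = a - c n * b -> s n * b1 = b - (c n)^* * a ->
  s n * x1 = x - c n * y -> s n * y1 = y - (c n)^* * x ->
  b1 * y1^* - a1 * x1^* = b * y^* - a * x^*.
Proof.
move=> a1E b1E x1E y1E; apply: (mulfI (expf_neq0 2 (s_neq0 n))).
have -> : s n ^+ 2 * (b1 * y1^* - a1 * x1^*) =
    (s n * b1) * (s n * y1)^* - (s n * a1) * (s n * x1)^*.
  by rewrite !rmorphM /= s_conj; ring.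
rewrite a1E b1E x1E y1E s_sqr !rmorphB !rmorphM /= conjCK; ring.
Qed.

(** The step matrix has determinant 1. Before it acts, [u] is multiplied by [z]; differentiating
    that factor contributes [u n * v n]. *)
Lemma wronskian_step n :
  u' n.+1 * v n.+1 - u n.+1 * v' n.+1 = u n * v n + z * (u' n * v n - u n * v' n).
Proof.
apply: (mulfI (expf_neq0 2 (s_neq0 n))).
have -> : s n ^+ 2 * (u' n.+1 * v n.+1 - u n.+1 * v' n.+1) =
    (s n * u' n.+1) * (s n * v n.+1) - (s n * u n.+1) * (s n * v' n.+1) by ring.
rewrite uE vE u'E v'E s_sqr; ring.
Qed.

Let k00 n := \sum_(j < n.+1) u j * (u j)^*.
Let k01 n := \sum_(j < n.+1) u j * (u' j)^*.
Let k11 n := \sum_(j < n.+1) u' j * (u' j)^*.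

(** Invariance turns the right side into [|v n|^2 - |z u n|^2], so going from [n] to [n.+1] adds
    [(1 - |z|^2) |u n.+1|^2]. *)
Lemma christoffel_darboux00 n :
  (1 - z * z^*) * k00 n = v n.+1 * (v n.+1)^* - u n.+1 * (u n.+1)^*.
Proof.
rewrite (lorentz_invariance (uE n) (vE n) (uE n) (vE n)).
elim: n => [|n IH].
  by rewrite /k00 big_ord1 uv0 !rmorphM /=; ring.
rewrite /k00 big_ord_recr /= mulrDr IH.
rewrite -(lorentz_invariance (uE n) (vE n) (uE n) (vE n)) !rmorphM /=; ring.
Qed.

(** Formally the derivative in [conj(w)] at [w = z] of [(1 - z conj(w)) K(z,w) = v(z) conj(v(w)) -
    u(z) conj(u(w))]; the next identity is also differentiated in [z]. Both follow by the same
    induction. *)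
Lemma christoffel_darboux01 n :
  (1 - z * z^*) * k01 n - z * k00 n =
  v n.+1 * (v' n.+1)^* - u n.+1 * (u' n.+1)^*.
Proof.
rewrite (lorentz_invariance (uE n) (vE n) (u'E n) (v'E n)).
elim: n => [|n IH].
  by rewrite /k01 /k00 !big_ord1 uv0 u'0 v'0 !rmorphD !rmorphM !rmorph0 /=; ring.
rewrite /k01 /k00 !(big_ord_recr n.+1) /= -/(k01 n) -/(k00 n) !mulrDr.
have -> : forall a b c d : C, a + b - (c + d) = (a - c) + (b - d) by move=> *; ring.
rewrite IH -(lorentz_invariance (uE n) (vE n) (u'E n) (v'E n)).
rewrite !rmorphD !rmorphM /=; ring.
Qed.

Lemma christoffel_darboux11 n :
  (1 - z * z^*) * k11 n - z^* * k01 n - k00 n - z * (k01 n)^* =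
  v' n.+1 * (v' n.+1)^* - u' n.+1 * (u' n.+1)^*.
Proof.
rewrite (lorentz_invariance (u'E n) (v'E n) (u'E n) (v'E n)).
elim: n => [|n IH].
  rewrite /k11 /k01 /k00 !big_ord1 u'0 v'0 !rmorphD !rmorphM !rmorph0 /=; ring.
rewrite /k11 /k01 /k00 !(big_ord_recr n.+1) /= -/(k01 n) -/(k00 n) -/(k11 n).
transitivity ((1 - z * z^*) * k11 n - z^* * k01 n - k00 n - z * (k01 n)^*
   + ((1 - z * z^*) * (u' n.+1 * (u' n.+1)^*) - z^* * (u n.+1 * (u' n.+1)^*)
   - u n.+1 * (u n.+1)^* - z * (u n.+1 * (u' n.+1)^*)^*)).
  by rewrite rmorphD /=; ring.
rewrite IH -(lorentz_invariance (u'E n) (v'E n) (u'E n) (v'E n)).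
rewrite !rmorphD !rmorphM /= conjCK; ring.
Qed.

Lemma k00_gt0 n : u 0 != 0 -> 0 < k00 n.
Proof.
move=> u00; rewrite /k00 big_ord_recl ltr_pwDl //.
  by rewrite -normCK exprn_gt0 // normr_gt0.
by apply: sumr_ge0 => i _; rewrite -normCK exprn_ge0.
Qed.

(* The Christoffel-Darboux identities give, with [D = 1 - |z|^2] and [K = k00],
   [D^2 (k11 K - |k01|^2) = K^2 - |wronskian|^2]. *)
Lemma intensity_wronskian n : u 0 != 0 -> `|z| != 1 ->
  (k11 n * k00 n - `|k01 n| ^+ 2) / k00 n ^+ 2 =
  ((1 - `|z| ^+ 2) ^+ 2)^-1 -
  `|u' n.+1 * v n.+1 - u n.+1 * v' n.+1| ^+ 2 /
  (`|v n.+1| ^+ 2 - `|u n.+1| ^+ 2) ^+ 2.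
Proof.
move=> u00 z1; rewrite !normCK.
have D0 : 1 - z * z^* != 0.
  by rewrite -normCK subr_eq0 eq_sym sqrf_eq1 negb_or z1 gt_eqF //
    (lt_le_trans _ (normr_ge0 _)) // ltrN10.
have K0 : k00 n != 0 by rewrite gt_eqF // k00_gt0.
rewrite -(christoffel_darboux00 n) -[in LHS]exprVn.
have cd00 := christoffel_darboux00 n.
have cd01 := christoffel_darboux01 n.
have cd11 := christoffel_darboux11 n.
have k00C : (k00 n)^* = k00 n by apply/CrealP; rewrite gtr0_real // k00_gt0.
have cd10 := congr1 Num.conj cd01.
rewrite !rmorphB !rmorphM /= rmorphB rmorph1 rmorphM /= conjCK k00C in cd10.
rewrite !conjCK in cd10.
have key : (1 - z * z^*) ^+ 2 * (k11 n * k00 n - k01 n * (k01 n)^*) =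
  k00 n ^+ 2 - (u' n.+1 * v n.+1 - u n.+1 * v' n.+1) *
  (u' n.+1 * v n.+1 - u n.+1 * v' n.+1)^*.
  rewrite !rmorphB !rmorphM /=.
  (* Gram identity for signature (1,1): the squared modulus of the determinant is minus the Gram
     determinant, whose entries are the right sides of the Christoffel-Darboux identities. *)
  have -> : (u' n.+1 * v n.+1 - u n.+1 * v' n.+1) *
    ((u' n.+1)^* * (v n.+1)^* - (u n.+1)^* * (v' n.+1)^*) =
   (v n.+1 * (v' n.+1)^* - u n.+1 * (u' n.+1)^*) *
   ((v n.+1)^* * v' n.+1 - (u n.+1)^* * u' n.+1) -
   (v n.+1 * (v n.+1)^* - u n.+1 * (u n.+1)^*) *
   (v' n.+1 * (v' n.+1)^* - u' n.+1 * (u' n.+1)^*) by ring.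
  by rewrite -cd00 -cd01 -cd10 -cd11; ring.
rewrite (_ : k11 n * k00 n - _ = ((1 - z * z^*) ^+ 2)^-1 *
  (k00 n ^+ 2 - (u' n.+1 * v n.+1 - u n.+1 * v' n.+1) *
  (u' n.+1 * v n.+1 - u n.+1 * v' n.+1)^*)); last first.
  by rewrite -key mulKf // expf_neq0.
by field; rewrite K0 D0.
Qed.

End KernelPoint.

(* Inside the disk [A] and [B] are the values of [phi*] and [phi] and
   [zeta = z]; outside they are exchanged and [zeta = t = z^-1]. *)
Lemma blaschke_step (C : numClosedFieldType)
    (zeta c s t k A B W A1 B1 W1 r e x y : C) :
  `|zeta| <= r -> `|k| <= 1 -> `|c| <= e -> 0 < s <= 1 -> t != 0 -> e < 1 ->
  0 <= x -> 0 <= y -> `|B| <= `|A| -> r <= 1 ->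
  `|B| <= x * `|A| -> `|W| <= y * `|A| ^+ 2 ->
  s * t * A1 = A - c^* * zeta * B -> s * t * B1 = zeta * B - c * A ->
  t ^+ 2 * W1 = k * A * B + zeta * W ->
  `|B1| <= (r * x + e) / (1 - e) * `|A1| /\
  `|W1| <= (x + r * y) / (1 - e) ^+ 2 * `|A1| ^+ 2.
Proof.
move=> zr k1 ce /andP[s0 s1] t0 e1 x0 y0 BA r1 Bx Wy A1E B1E W1E.
have r0 : 0 <= r := le_trans (normr_ge0 _) zr.
have e0 : 0 <= e := le_trans (normr_ge0 _) ce.
have tt0 : 0 < `|t| by rewrite normr_gt0.
have sN : `|s| = s by rewrite gtr0_norm.
(* Since [|c^* zeta B| <= e |A|], [A1] cannot be much smaller than [A]; this supplies the factors
   [1 - e] in both denominators. *)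
have A1lb : (1 - e) * `|A| <= s * `|t| * `|A1|.
  rewrite -{1}sN -!normrM A1E mulrBl mul1r.
  apply: le_trans (lerB_dist _ _); rewrite lerB // !normrM norm_conjC -mulrA.
  apply: ler_pM => //; rewrite ?mulr_ge0 //.
  by rewrite (le_trans _ BA) // ler_piMl // (le_trans zr).
have B1ub : s * `|t| * `|B1| <= (r * x + e) * `|A|.
  rewrite -{1}sN -!normrM B1E (le_trans (ler_normB _ _)) // !normrM mulrDl.
  by rewrite lerD // ?ler_wpM2r // -mulrA ler_pM.
have W1ub : `|t| ^+ 2 * `|W1| <= (x + r * y) * `|A| ^+ 2.
  rewrite -normrX -normrM W1E (le_trans (ler_normD _ _)) // !normrM mulrDl.
  rewrite lerD //; last by rewrite -mulrA ler_pM.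
  rewrite -mulrA (le_trans (ler_piMl _ k1)) ?mulr_ge0 //.
  by rewrite mulrC expr2 mulrA ler_wpM2r.
have e10 : 0 < 1 - e by rewrite subr_gt0.
have rxe : 0 <= r * x + e by rewrite addr_ge0 ?mulr_ge0.
split.
  rewrite mulrAC ler_pdivlMr // -(ler_pM2l (mulr_gt0 s0 tt0)) mulrA.
  rewrite (le_trans (ler_wpM2r (ltW e10) B1ub)) //.
  by rewrite -[leLHS]mulrA [leRHS]mulrCA; apply: ler_wpM2l => //; rewrite mulrC.
have xry : 0 <= x + r * y by rewrite addr_ge0 ?mulr_ge0.
rewrite mulrAC ler_pdivlMr ?exprn_gt0 // -(ler_pM2l (exprn_gt0 2 tt0)) mulrA.
rewrite (le_trans (ler_wpM2r (ltW (exprn_gt0 2 e10)) W1ub)) //.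
rewrite -[leLHS]mulrA [leRHS]mulrCA; apply: ler_wpM2l => //.
rewrite -!exprMn [`|A| * _]mulrC.
apply: lerXn2r; rewrite ?nnegrE ?mulr_ge0 ?(ltW e10) //.
by rewrite (le_trans A1lb) // -mulrA ler_piMl ?mulr_ge0.
Qed.

Local Open Scope classical_set_scope.
Local Open Scope ring_scope.
Local Open Scope complex_scope.

(** * The inner product of a weight *)

Section ComplexParts.
Variable R : realType.
Implicit Types x y : R[i].

Lemma Re_addc x y : complex.Re (x + y) = complex.Re x + complex.Re y.
Proof. by case: x => a b; case: y. Qed.

Lemma Im_addc x y : complex.Im (x + y) = complex.Im x + complex.Im y.
Proof. by case: x => a b; case: y. Qed.

Lemma Re_mulc x y : complex.Re (x * y) =
  complex.Re x * complex.Re y - complex.Im x * complex.Im y.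
Proof. by case: x => a b; case: y. Qed.

Lemma Im_mulc x y : complex.Im (x * y) =
  complex.Re x * complex.Im y + complex.Im x * complex.Re y.
Proof. by case: x => a b; case: y => c d. Qed.

Lemma Re_conjc x : complex.Re (Num.conj x) = complex.Re x.
Proof. by case: x. Qed.

Lemma Im_conjc x : complex.Im (Num.conj x) = - complex.Im x.
Proof. by case: x. Qed.

Lemma conjC_complex (x y : R) : Num.conj (x +i* y) = x -i* y.
Proof. by []. Qed.

Lemma conjC_real (x : R) : Num.conj x%:C = x%:C.
Proof. by rewrite conjC_complex oppr0. Qed.

Lemma norm_expi (t : R) : `|expi t| = 1.
Proof. by rewrite normc_def /= cos2Dsin2 sqrtr1. Qed.

Lemma expiM n (t : R) : expi t ^+ n = expi (n%:R * t).
Proof.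
elim: n => [|n IH]; first by rewrite mul0r /expi cos0 sin0.
rewrite exprS IH -natr1 mulrDl mul1r addrC /expi cosD sinD.
by apply/eqP; rewrite eq_complex /= eqxx [X in _ == X]addrC eqxx.
Qed.

End ComplexParts.

Section ComplexIntegral.
Variable R : realType.
Implicit Types (f g : R -> R[i]) (D : set R).

Definition parts_continuous f :=
  continuous (fun t => complex.Re (f t)) /\
  continuous (fun t => complex.Im (f t)).

Definition parts_integrable D f :=
  lebesgue_measure.-integrable D (EFin \o (fun t => complex.Re (f t))) /\
  lebesgue_measure.-integrable D (EFin \o (fun t => complex.Im (f t))).

Lemma parts_continuous_cst (a : R[i]) : parts_continuous (fun=> a).
Proof. by split; exact: cst_continuous. Qed.

Lemma parts_continuousD f g : parts_continuous f -> parts_continuous g ->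
  parts_continuous (fun t => f t + g t).
Proof.
move=> [rf jf] [rg jg]; split=> t.
  under eq_fun do rewrite Re_addc.
  by apply: cvgD; [exact: rf|exact: rg].
under eq_fun do rewrite Im_addc.
by apply: cvgD; [exact: jf|exact: jg].
Qed.

Lemma parts_continuousM f g : parts_continuous f -> parts_continuous g ->
  parts_continuous (fun t => f t * g t).
Proof.
move=> [rf jf] [rg jg]; split=> t.
  under eq_fun do rewrite Re_mulc.
  by apply: cvgB; apply: cvgM; [exact: rf|exact: rg|exact: jf|exact: jg].
under eq_fun do rewrite Im_mulc.
by apply: cvgD; apply: cvgM; [exact: rf|exact: jg|exact: jf|exact: rg].
Qed.

Lemma parts_continuousJ f : parts_continuous f ->
  parts_continuous (fun t => Num.conj (f t)).
Proof.
move=> [rf jf]; split=> t.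
  by under eq_fun do rewrite Re_conjc; exact: rf.
by under eq_fun do rewrite Im_conjc; apply: cvgN; exact: jf.
Qed.

Lemma parts_continuous_expi : parts_continuous (@expi R).
Proof. by split; [exact: continuous_cos|exact: continuous_sin]. Qed.

Lemma parts_continuous_horner (p : {poly R[i]}) f :
  parts_continuous f -> parts_continuous (fun t => p.[f t]).
Proof.
move=> cf; elim/poly_ind: p => [|p a IH].
  by under eq_fun do rewrite horner0; exact: parts_continuous_cst.
under eq_fun do rewrite hornerMXaddC.
apply: parts_continuousD; last exact: parts_continuous_cst.
exact: parts_continuousM.
Qed.

Variable D : set R.
Hypothesis mD : measurable (D : set (measurableTypeR R)).

Lemma CintegralD f g : parts_integrable D f -> parts_integrable D g ->
  Cintegral D (fun t => f t + g t) = Cintegral D f + Cintegral D g.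
Proof.
move=> [rf jf] [rg jg]; rewrite /Cintegral.
under eq_Rintegral do rewrite Re_addc.
under [in X in _ +i* X]eq_Rintegral do rewrite Im_addc.
by rewrite !RintegralD.
Qed.

Lemma parts_integrableZ a f : parts_integrable D f ->
  parts_integrable D (fun t => a * f t).
Proof.
move=> [rf jf]; split.
  have := integrableB mD (integrableZl mD (complex.Re a) rf)
    (integrableZl mD (complex.Im a) jf).
  by apply: eq_integrable => // t _; rewrite /= Re_mulc.
have := integrableD mD (integrableZl mD (complex.Re a) jf)
    (integrableZl mD (complex.Im a) rf).
by apply: eq_integrable => // t _; rewrite /= Im_mulc.
Qed.

Lemma CintegralZ a f : parts_integrable D f ->
  Cintegral D (fun t => a * f t) = a * Cintegral D f.
Proof.
move=> [rf jf]; rewrite /Cintegral.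
under eq_Rintegral do rewrite Re_mulc.
under [in X in _ +i* X]eq_Rintegral do rewrite Im_mulc.
have Z (b : R) h : lebesgue_measure.-integrable D (EFin \o h) ->
    lebesgue_measure.-integrable D (EFin \o (fun t => b * h t)).
  exact: (integrableZl mD b).
rewrite RintegralB ?RintegralD ?RintegralZl //; try exact: Z.
by case: a.
Qed.

Lemma CintegralJ f : parts_integrable D f ->
  Cintegral D (fun t => Num.conj (f t)) = Num.conj (Cintegral D f).
Proof.
move=> [rf jf]; rewrite /Cintegral conjC_complex.
under eq_Rintegral do rewrite Re_conjc.
under [in X in _ +i* X]eq_Rintegral do rewrite Im_conjc -mulN1r.
by rewrite RintegralZl // mulN1r.
Qed.

Lemma eq_Cintegral f g : (forall t, f t = g t) -> Cintegral D f = Cintegral D g.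
Proof. by move=> fg; congr Cintegral; apply/funext. Qed.

End ComplexIntegral.

Section SzegoForm.
Variables (R : realType) (W : R -> R).
Hypothesis W_ge0 : forall t, t \in `[- pi, pi] -> 0 <= W t.
Hypothesis W_meas : measurable_fun `[- pi, pi] W.
Hypothesis W_fin :
  (\int[lebesgue_measure]_(t in `[(- pi)%R, pi]) (W t)%:E < +oo)%E.

Let circle : set R := `[- pi, pi].
Let mcircle : measurable (circle : set (measurableTypeR R)). Proof. exact: measurable_itv. Qed.

Lemma weight_integrable : lebesgue_measure.-integrable circle (EFin \o W).
Proof.
apply/integrableP; split; first exact/measurable_EFinP.
rewrite (_ : \int[_]_(_ in _) _ = \int[lebesgue_measure]_(t in circle) (W t)%:E)%E //.
by apply: eq_integral => t; rewrite inE /= => tD; rewrite ger0_norm // W_ge0.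
Qed.

(** A continuous [g] is bounded on the compact interval, so the product is dominated by a multiple
    of [W]. *)
Lemma weight_mul_integrable (g : R -> R) : continuous g ->
  lebesgue_measure.-integrable circle (EFin \o (fun t => W t * g t)).
Proof.
move=> cg.
have [M M0 gM] : exists2 M, 0 < M & forall t, circle t -> `|g t| <= M.
  have : compact (g @` circle).
    apply: continuous_compact; last exact: segment_compact.
    exact: continuous_subspaceT.
  (* [compact_bounded] gives every number strictly above [M] as a bound; [Num.max 0 M + 1] is one,
     and it is positive. *)
  move=> /compact_bounded [M [Mr gM]]; exists (Num.max 0 M + 1).
    by rewrite ltr_wpDl // le_max lexx.
  move=> t tD; apply: (gM (Num.max 0 M + 1)); last by exists t.
  by rewrite (le_lt_trans (_ : M <= Num.max 0 M)) ?ltrDl // le_max lexx orbT.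
apply: (le_integrable mcircle _ _ (integrableZl mcircle M weight_integrable)).
  apply/measurable_EFinP; apply: measurable_funM => //.
  by apply: measurable_funTS; exact: continuous_measurable_fun.
move=> t tD; rewrite /= lee_fin normrM mulrC [leRHS]normrM.
by rewrite ler_wpM2r // (le_trans (gM t tD)) // ler_norm.
Qed.

Lemma weight_mul_parts_integrable f : parts_continuous f ->
  parts_integrable circle (fun t => (W t)%:C * f t).
Proof.
move=> [rf jf]; split.
  have := weight_mul_integrable rf; apply: eq_integrable => // t _.
  by rewrite /= Re_mulc /= mul0r subr0.
have := weight_mul_integrable jf; apply: eq_integrable => // t _.
by rewrite /= Im_mulc /= mul0r addr0.
Qed.

(** This repeats the expression in [is_OPUC], so that the orthonormality of [phi] is literally a
    statement about this form. *)
Definition szego_form (p q : {poly R[i]}) : R[i] :=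
  ((2 * pi)^-1)%:C *
  Cintegral circle (fun t => (W t)%:C * p.[expi t] * Num.conj (q.[expi t])).

Lemma szego_form_integrable (p q : {poly R[i]}) :
  parts_integrable circle (fun t => (W t)%:C * p.[expi t] * Num.conj q.[expi t]).
Proof.
under eq_fun do rewrite -mulrA.
apply/weight_mul_parts_integrable/parts_continuousM.
  exact/parts_continuous_horner/parts_continuous_expi.
exact/parts_continuousJ/parts_continuous_horner/parts_continuous_expi.
Qed.

(** On the circle, ['X] has modulus 1 and reversal conjugates the value up to the factor
    [expi t ^+ n]; these factors cancel against their conjugates. *)
Lemma szego_form_toeplitz : toeplitz_form szego_form.
Proof.
have expi1 t : expi t * Num.conj (expi t) = 1 :> R[i].
  by rewrite -normCK norm_expi expr1n.
split.
- move=> a p q r; rewrite /szego_form mulrCA -mulrDr; congr (_ * _).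
  have pr := szego_form_integrable p r; have qr := szego_form_integrable q r.
  rewrite -(CintegralZ mcircle a pr) -(CintegralD mcircle _ qr).
    by apply: eq_Cintegral => t; rewrite hornerD hornerZ; ring.
  exact: parts_integrableZ.
- move=> p q; rewrite /szego_form rmorphM /=.
  rewrite -CintegralJ //; last exact: szego_form_integrable.
  congr (_ * _); first by rewrite conjC_real.
  apply: eq_Cintegral => t; rewrite !rmorphM /= conjCK conjC_real; ring.
- move=> p q; rewrite /szego_form; congr (_ * _); apply: eq_Cintegral => t.
  rewrite !hornerM !hornerX rmorphM /= -[RHS]mulr1 -(expi1 t); ring.
- move=> n p q sp sq; rewrite /szego_form; congr (_ * _).
  apply: eq_Cintegral => t.
  rewrite !horner_reversed ?norm_expi // !rmorphM !rmorphXn /= conjCK.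
  transitivity ((W t)%:C * q.[expi t] * Num.conj p.[expi t] *
    (expi t * Num.conj (expi t)) ^+ n); last by rewrite expi1 expr1n mulr1.
  rewrite exprMn; ring.
Qed.

End SzegoForm.

(** * Logarithmic means over the circle *)

Local Notation normc := (ComplexField.Normc.normc).

Section NormC.
Variable R : realType.
Implicit Types (x y : R[i]).

(** Passes between the modulus with values in [R[i]] and the real-valued [normc]. *)
Lemma normE x : `|x| = (normc x)%:C. Proof. by []. Qed.

Lemma normc_sqr x : normc x ^+ 2 = complex.Re x ^+ 2 + complex.Im x ^+ 2.
Proof. by case: x => a b; rewrite /= sqr_sqrtr // addr_ge0 ?sqr_ge0. Qed.

Lemma normc_ge0 x : 0 <= normc x.
Proof. by case: x => a b; exact: sqrtr_ge0. Qed.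

Lemma normc_gt0 x : x != 0 -> 0 < normc x.
Proof. by move=> x0; rewrite -ltcR -normE normr_gt0. Qed.

Lemma normcX x n : normc (x ^+ n) = normc x ^+ n.
Proof.
elim: n => [|n IH]; first by rewrite !expr0 ComplexField.Normc.normc1.
by rewrite !exprS ComplexField.Normc.normcM IH.
Qed.

Lemma normc_conj x : normc (Num.conj x) = normc x.
Proof. by apply: complexI; rewrite -!normE norm_conjC. Qed.

Lemma Re_le_normc x : complex.Re x <= normc x.
Proof.
have := normc_ge_Re x; rewrite normE lecR; exact/le_trans/ler_norm.
Qed.

Lemma normc_real (a : R) : 0 <= a -> normc a%:C = a.
Proof. by move=> a0; rewrite /= expr0n /= addr0 sqrtr_sqr ger0_norm. Qed.

Lemma normc_expi (t : R) : normc (expi t) = 1.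
Proof. by apply: complexI; rewrite -normE norm_expi. Qed.

End NormC.

(** * Taylor bounds for [ln |1 - w|^2] and means of powers *)

Section LogTaylor.
Variable R : realType.
Implicit Types (w a : R[i]) (s t : R) (m k : nat).

(* Minus the real part of the Taylor polynomial of [log (1 - w)]. *)
Definition log_taylor m w : R :=
  \sum_(k < m) complex.Re (w ^+ k.+1) / k.+1%:R.

(** Bounds twice the remainder of the geometric series for [|w| = N]; the factor 2 comes from the
    squared modulus. *)
Definition log_error m (N : R) : R := 2 * (N ^+ m.+1 / (1 - N)).

Lemma Re_sum (I : Type) (r : seq I) (F : I -> R[i]) :
  complex.Re (\sum_(i <- r) F i) = \sum_(i <- r) complex.Re (F i).
Proof. exact: (big_morph (@complex.Re R) (@Re_addc R) erefl). Qed.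

Lemma subr1_neq0 w : normc w < 1 -> 1 - w != 0.
Proof.
apply: contraTneq => /eqP; rewrite subr_eq0 => /eqP <-.
by rewrite ComplexField.Normc.normc1 ltxx.
Qed.

(** The right side is the derivative in [s] of [ln |1 - s w|^2] plus twice the Taylor sum at [s w].
    Summing the geometric series leaves only [- 2 Re(w (s w)^m / (1 - s w))]. *)
Lemma ln_normc_subr1_derive_ge w m s : normc w < 1 -> 0 <= s <= 1 ->
  - log_error m (normc w) <=
  - (2 * complex.Re (w / (1 - s%:C * w)))
  + 2 * \sum_(k < m) complex.Re (w ^+ k.+1) * s ^+ k.
Proof.
move=> w1 /andP[s0 s1]; have w0 := normc_ge0 w.
have sw1 : normc (s%:C * w) <= normc w.
  by rewrite ComplexField.Normc.normcM normc_real // ler_piMl.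
have ne0 := subr1_neq0 (le_lt_trans sw1 w1).
have -> : \sum_(k < m) complex.Re (w ^+ k.+1) * s ^+ k =
    complex.Re (w / (1 - s%:C * w)) -
    complex.Re (w * (s%:C * w) ^+ m / (1 - s%:C * w)).
  transitivity (complex.Re (\sum_(k < m) w * (s%:C * w) ^+ k)).
    rewrite Re_sum; apply: eq_bigr => k _.
    rewrite exprMn mulrCA -exprS.
    have -> : s%:C ^+ k = (s ^+ k)%:C by rewrite rmorphXn.
    rewrite [RHS]Re_mulc [complex.Re (_ %:C)]/= [complex.Im (_ %:C)]/=.
    by rewrite mul0r subr0 mulrC.
  rewrite -mulr_sumr; have /eqP := subrX1 (s%:C * w) m.
  rewrite -[_ - 1]opprB -[s%:C * w - 1]opprB mulNr eqr_opp => /eqP geo.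
  have -> : \sum_(i < m) (s%:C * w) ^+ i = (1 - (s%:C * w) ^+ m) / (1 - s%:C * w).
    by rewrite geo mulrAC divff ?mul1r.
  rewrite mulrA mulrBr mulr1 mulrBl.
  by set x := w / _; set y := _ / _; case: x y => ? ? [].
set q := _ * _ / _.
suff : complex.Re q <= normc w ^+ m.+1 / (1 - normc w) by rewrite /log_error; lra.
apply: (le_trans (Re_le_normc q)); rewrite /q.
rewrite !ComplexField.Normc.normcM ComplexField.Normc.normcV normcX exprS.
have lb : 1 - normc w <= normc (1 - s%:C * w).
  rewrite -lecR -normE rmorphB rmorph1 /=.
  apply: le_trans (lerB_dist _ _); rewrite normr1 lerB //.
  by rewrite normE lecR.
have lb0 : 0 < 1 - normc w by lra.
apply: ler_pM; rewrite ?mulr_ge0 ?exprn_ge0 ?normc_ge0 ?invr_ge0 ?normc_ge0 //.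
  by rewrite ler_wpM2l // lerXn2r // nnegrE ?normc_ge0.
by rewrite lef_pV2 // posrE (lt_le_trans lb0).
Qed.

(** Mean value theorem on [[0, 1]]: [g] vanishes at 0, so its value at 1 is one of the derivatives
    just bounded. *)
Lemma ln_normc_subr1_ge w m : normc w < 1 ->
  - (2 * log_taylor m w) - log_error m (normc w) <= ln (normc (1 - w) ^+ 2).
Proof.
move=> w1.
(* For real [s], [Q] is [|1 - s w|^2] and [P] is twice the Taylor sum at [s w]; as polynomials in
   [s] they are differentiated algebraically. *)
pose Q : {poly R} := 1 - (2 * complex.Re w) *: 'X + (normc w ^+ 2) *: 'X^2.
pose P : {poly R} :=
  \sum_(k < m) (2 * complex.Re (w ^+ k.+1) / k.+1%:R) *: 'X^(k.+1).
pose g s := ln Q.[s] + P.[s].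
have QE s : Q.[s] = normc (1 - s%:C * w) ^+ 2.
  rewrite !normc_sqr /Q !hornerE normc_sqr /=.
  by case: (w) => a b /=; rewrite mul0r mul0r subr0 addr0; ring.
have Q0 s : 0 <= s <= 1 -> 0 < Q.[s].
  move=> /andP[s0 s1]; rewrite QE exprn_gt0 // normc_gt0 // subr1_neq0 //.
  rewrite ComplexField.Normc.normcM normc_real //.
  by rewrite (le_lt_trans _ w1) // ler_piMl // normc_ge0.
have P'E s : P^`().[s] = 2 * \sum_(k < m) complex.Re (w ^+ k.+1) * s ^+ k.
  rewrite /P raddf_sum horner_sum mulr_sumr; apply: eq_bigr => k _ /=.
  rewrite derivZ derivXn hornerZ hornerMn hornerXn -mulr_natr /=.
  have : k.+1%:R != 0 :> R by rewrite pnatr_eq0.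
  by move=> k0; field.
have Q'E s : 0 <= s <= 1 ->
    Q.[s]^-1 * Q^`().[s] = - (2 * complex.Re (w / (1 - s%:C * w))).
  move=> s01; have := Q0 _ s01; rewrite QE normc_sqr /Q => Qs.
  rewrite !poly.derivE !hornerE /= normc_sqr.
  move: Qs; case: (w) => a b /=; rewrite !mul0r !subr0 !addr0 !sub0r => Qs.
  by field; rewrite gt_eqF.
have dg s : 0 <= s <= 1 -> is_derive s (1 : R) g
    (- (2 * complex.Re (w / (1 - s%:C * w))) +
     2 * \sum_(k < m) complex.Re (w ^+ k.+1) * s ^+ k).
  move=> s01; rewrite -Q'E // -P'E; apply: is_deriveD.
  exact: (is_derive1_comp (is_derive1_ln (Q0 _ s01))).
have [||s s01] := MVT ltr01 (f := g)
    (df := fun s => - (2 * complex.Re (w / (1 - s%:C * w))) +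
     2 * \sum_(k < m) complex.Re (w ^+ k.+1) * s ^+ k).
- by move=> s; rewrite in_itv /= => /andP[/ltW s0 /ltW s1]; apply/dg/andP.
- apply: derivable_within_continuous => s; rewrite in_itv /= => s01.
  by have [] := dg _ s01.
have {}s01 : 0 <= s <= 1.
  by move: s01; rewrite in_itv /= => /andP[/ltW -> /ltW ->].
rewrite subr0 mulr1 => gE.
have := ln_normc_subr1_derive_ge m w1 s01; rewrite -gE /g !QE mul0r subr0.
rewrite ComplexField.Normc.normc1 expr1n ln1 mul1r.
have -> : P.[0] = 0.
  rewrite /P horner_sum big1 // => k _.
  by rewrite hornerZ hornerXn expr0n mulr0.
have -> : P.[1] = 2 * log_taylor m w.
  rewrite /P horner_sum mulr_sumr; apply: eq_bigr => k _.
  by rewrite hornerZ hornerXn expr1n mulr1 mulrA.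
lra.
Qed.

Lemma sin_natmul_pi k : sin (k%:R * pi) = 0 :> R.
Proof.
have := congr1 (@complex.Im R) (expiM k (pi : R)) => /= <-.
have -> : expi (pi : R) = -1.
  by apply/eqP; rewrite eq_complex /= cospi sinpi oppr0 !eqxx.
by rewrite -signr_odd; case: odd; rewrite ?expr0 ?expr1 /= ?oppr0.
Qed.

Lemma Re_powerE a k t : complex.Re ((a * Num.conj (expi t)) ^+ k) =
  complex.Re (a ^+ k) * cos (k%:R * t) + complex.Im (a ^+ k) * sin (k%:R * t).
Proof.
by rewrite exprMn -rmorphXn expiM Re_mulc Re_conjc Im_conjc /= mulrN opprK.
Qed.

Lemma continuous_Re_power a k :
  continuous (fun t => complex.Re ((a * Num.conj (expi t)) ^+ k)).
Proof.
have -> : (fun t => complex.Re ((a * Num.conj (expi t)) ^+ k)) =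
    (fun t => complex.Re ((a *: 'X) ^+ k).[Num.conj (expi t)]).
  by apply/funext => t; rewrite horner_exp hornerZ hornerX.
apply: (proj1 (parts_continuous_horner _ _)).
exact/parts_continuousJ/parts_continuous_expi.
Qed.

Lemma Rintegral_Re_power a k :
  \int[lebesgue_measure]_(t in `[- pi, pi])
    complex.Re ((a * Num.conj (expi t)) ^+ k.+1) = 0.
Proof.
pose b := a ^+ k.+1; pose n : R := k.+1%:R.
have n0 : n != 0 by rewrite pnatr_eq0.
(* An explicit antiderivative: at [pi] and [- pi] the sine terms vanish and the cosine terms
   agree. *)
pose F t := n^-1 * (complex.Re b * sin (n * t) - complex.Im b * cos (n * t)).
have dF t : is_derive t (1 : R) F (complex.Re ((a * Num.conj (expi t)) ^+ k.+1)).
  have dn : is_derive t (1 : R) ( *%R n : R -> R) n.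
    have -> : ( *%R n : R -> R) = horner (n *: 'X).
      by apply/funext => u; rewrite hornerZ hornerX.
    apply: (is_derive_eq (is_derive_poly _ _)).
    by rewrite derivZ derivX hornerZ hornerC mulr1.
  have ds := is_derive1_comp (is_derive_sin (n * t)) dn.
  have dc := is_derive1_comp (is_derive_cos (n * t)) dn.
  have := is_deriveZ n^-1 (is_deriveB (is_deriveZ (complex.Re b) ds)
    (is_deriveZ (complex.Im b) dc)).
  move=> dF; apply: (is_derive_eq dF).
  rewrite Re_powerE -/b -/n /GRing.scale /=; field.
  by [].
have cF : continuous F.
  by move=> t; apply/differentiable_continuous/derivable1_diffP; have [] := dF t.
have pi0 : - pi < pi :> R by rewrite gtrN // pi_gt0.
rewrite /Rintegral (@continuous_FTC2 _ _ F) //.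
- rewrite /F mulrN cosN sinN !sin_natmul_pi oppr0 -EFinB /= subrr //.
- exact/continuous_subspaceT/continuous_Re_power.
- split.
  + by move=> t _; have [] := dF t.
  + exact/cvg_at_right_filter/cF.
  + exact/cvg_at_left_filter/cF.
- by move=> t _; rewrite derive1E; exact: derive_val.
Qed.

End LogTaylor.

Section ZeroMean.
Variable R : realType.
Let circle : set R := `[- pi, pi].
Let mcircle : measurable (circle : set (measurableTypeR R)).
Proof. exact: measurable_itv. Qed.

Definition zero_mean (f : R -> R) :=
  lebesgue_measure.-integrable `[- pi, pi] (EFin \o f) /\
  \int[lebesgue_measure]_(t in `[- pi, pi]) f t = 0.

Lemma continuous_circle_integrable (f : R -> R) : continuous f ->
  lebesgue_measure.-integrable circle (EFin \o f).
Proof.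
move=> cf; apply: continuous_compact_integrable; first exact: segment_compact.
exact: continuous_subspaceT.
Qed.

Lemma lebesgue_circle : lebesgue_measure circle = (2 * pi)%:E.
Proof.
rewrite lebesgue_measure_itv /= lte_fin gtrN ?pi_gt0 // -EFinB opprK.
by rewrite mulr_natl mulr2n.
Qed.

Lemma zero_meanD f g : zero_mean f -> zero_mean g ->
  zero_mean (fun t => f t + g t).
Proof.
move=> [fi f0] [gi g0]; split; first by apply: eq_integrable (integrableD mcircle fi gi).
by rewrite RintegralD // f0 g0 addr0.
Qed.

Lemma zero_meanZ a f : zero_mean f -> zero_mean (fun t => a * f t).
Proof.
move=> [fi f0]; split; first by apply: eq_integrable (integrableZl mcircle a fi).
by rewrite RintegralZl // f0 mulr0.
Qed.

Lemma zero_mean_sum (I : Type) (r : seq I) (f : I -> R -> R) :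
  (forall i, zero_mean (f i)) -> zero_mean (fun t => \sum_(i <- r) f i t).
Proof.
move=> f0; elim: r => [|i r IH].
  under eq_fun do rewrite big_nil; split; last by rewrite Rintegral_cst // mul0r.
  exact/continuous_circle_integrable/cst_continuous.
under eq_fun do rewrite big_cons.
exact: zero_meanD.
Qed.

Lemma zero_mean_log_taylor m (a : R[i]) :
  zero_mean (fun t => log_taylor m (a * Num.conj (expi t))).
Proof.
apply: zero_mean_sum => k; under eq_fun do rewrite mulrC.
apply: zero_meanZ; split; last exact: Rintegral_Re_power.
exact/continuous_circle_integrable/continuous_Re_power.
Qed.

Lemma zero_mean_cst a f : zero_mean f ->
  lebesgue_measure.-integrable circle (EFin \o (fun t => a + f t)) /\
  \int[lebesgue_measure]_(t in circle) (a + f t) = 2 * pi * a.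
Proof.
move=> [fi f0].
have ai : lebesgue_measure.-integrable circle (EFin \o (fun=> a)).
  exact/continuous_circle_integrable/cst_continuous.
split; first by apply: eq_integrable (integrableD mcircle ai fi).
rewrite RintegralD // f0 addr0 Rintegral_cst // mulrC; congr (_ * _).
exact: (congr1 fine lebesgue_circle).
Qed.

End ZeroMean.

Section LogMean.
Variable R : realType.

Lemma log_error_cvg0 (N : R) : 0 <= N < 1 -> log_error m N @[m --> \oo] --> 0.
Proof.
move=> /andP[N0 N1].
have -> : (fun m => log_error m N) =
    (fun m => (2 * N / (1 - N)) * N ^+ m).
  by apply/funext => m; rewrite /log_error exprS; ring.
rewrite -[X in _ --> X](mulr0 (2 * N / (1 - N))).
by apply: cvgM; [exact: cvg_cst|apply: cvg_expr; rewrite ger0_norm].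
Qed.

Lemma sum_log_error_cvg0 (r : seq R[i]) : (forall a, a \in r -> normc a < 1) ->
  (\sum_(a <- r) log_error m (normc a)) @[m --> \oo] --> 0.
Proof.
elim: r => [|a r IH] r1; first by under eq_fun do rewrite big_nil; exact: cvg_cst.
rewrite -[X in _ --> X](addr0 0); under eq_fun do rewrite big_cons.
apply: cvgD; last by apply: IH => b br; rewrite r1 // in_cons br orbT.
by apply: log_error_cvg0; rewrite normc_ge0 r1 // mem_head.
Qed.

Lemma ln_normc_prod (r : seq R[i]) x : (forall a, a \in r -> normc a < normc x) ->
  normc (\prod_(a <- r) (x - a)) ^+ 2 > 0 /\
  ln (normc (\prod_(a <- r) (x - a)) ^+ 2) =
  \sum_(a <- r) ln (normc (x - a) ^+ 2).
Proof.
elim: r => [|a r IH] ar.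
  by rewrite !big_nil ComplexField.Normc.normc1 expr1n ln1.
rewrite !big_cons; have [|p0 <-] := IH.
  by move=> b br; apply: ar; rewrite in_cons br orbT.
have xa : 0 < normc (x - a) ^+ 2.
  rewrite exprn_gt0 // normc_gt0 // subr_eq0.
  by apply: contraTneq (ar a (mem_head _ _)) => ->; rewrite ltxx.
by rewrite ComplexField.Normc.normcM exprMn mulr_gt0 // lnM ?posrE.
Qed.

(** Factoring out the unimodular [expi t] gives the form [1 - w] with [|w| = |a|], to which the
    Taylor bound applies. *)
Lemma normc_expi_sub (a : R[i]) t :
  normc (expi t - a) = normc (1 - a * Num.conj (expi t)).
Proof.
have -> : 1 - a * Num.conj (expi t) = Num.conj (expi t) * (expi t - a).
  have : expi t * Num.conj (expi t) = 1 :> R[i].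
    by rewrite -normCK norm_expi expr1n.
  by move=> <-; ring.
by rewrite ComplexField.Normc.normcM normc_conj normc_expi mul1r.
Qed.

(** Sums the Taylor bounds over the roots. The lower bound is a constant plus a trigonometric
    polynomial of mean zero, so its integral is explicit. *)
Lemma ln_normc_poly_ge (p : {poly R[i]}) (r : seq R[i]) m t :
  p = lead_coef p *: \prod_(a <- r) ('X - a%:P) -> p != 0 ->
  (forall a, a \in r -> normc a < 1) ->
  0 < normc p.[expi t] ^+ 2 /\
  (ln (normc (lead_coef p) ^+ 2) - \sum_(a <- r) log_error m (normc a)) +
  - 2 * \sum_(a <- r) log_taylor m (a * Num.conj (expi t)) <=
  ln (normc p.[expi t] ^+ 2).
Proof.
move=> pE p0 r1.
have -> : p.[expi t] = lead_coef p * \prod_(a <- r) (expi t - a).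
  rewrite {1}pE hornerZ horner_prod; congr (_ * _).
  by apply: eq_bigr => a _; rewrite hornerXsubC.
have [|prod0 lnE] := @ln_normc_prod r (expi t).
  by move=> a ar; rewrite normc_expi r1.
have lead0 : 0 < normc (lead_coef p) ^+ 2.
  by rewrite exprn_gt0 // normc_gt0 // lead_coef_eq0.
rewrite ComplexField.Normc.normcM exprMn mulr_gt0 // [X in _ <= X]lnM ?posrE // lnE.
split=> //; rewrite -addrA lerD2l mulr_sumr -sumrN -big_split /=.
rewrite !big_seq; apply: ler_sum => a ar.
rewrite normc_expi_sub.
have : normc (a * Num.conj (expi t)) < 1.
  by rewrite ComplexField.Normc.normcM normc_conj normc_expi mulr1 r1.
move=> /(ln_normc_subr1_ge m).
rewrite ComplexField.Normc.normcM normc_conj normc_expi mulr1; lra.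
Qed.

End LogMean.

(** * Entropy bound for the leading coefficient *)

Section LogWeight.
Variables (R : realType) (W : R -> R).
Hypothesis W_szego : szego_class W.

Let circle : set R := `[- pi, pi].
Let mcircle : measurable (circle : set (measurableTypeR R)).
Proof. exact: measurable_itv. Qed.

Let L := (\int[lebesgue_measure]_(t in circle) `|lne (W t)%:E|)%E.

Lemma abs_lne_integrable :
  lebesgue_measure.-integrable circle (fun t => `|lne (W t)%:E|)%E.
Proof.
have [W0 Wm _ Wl] := W_szego.
apply/integrableP; split; last by under eq_integral do rewrite abse_id.
apply: measurableT_comp => //.
have -> : (fun t => lne (W t)%:E) =
    (fun t => if 0 < W t then (ln (W t))%:E else -oo%E).
  apply/funext => t; case: ltP => Wt; first by rewrite lne_EFin.
  by rewrite le0_lneNy.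
apply: measurable_fun_if => //.
- apply: measurable_fun_ltr => //; exact: measurable_cst.
- apply: (@measurable_funS _ _ _ _ circle) => //.
  apply/measurable_EFinP; apply: measurableT_comp => //; exact: measurable_ln.
Qed.

(* Since [x >= 1 + ln x], the integral of [W |p|^2] is bounded below by that of
   [1 + ln W + ln |p|^2]; the mean of [ln |p|^2] on the circle is
   [ln |lead_coef p|^2] when all roots lie in the open disk. *)
Lemma ln_lead_coef_le (p : {poly R[i]}) : p != 0 ->
  (forall a, root p a -> normc a < 1) ->
  2 * pi * (1 + ln (normc (lead_coef p) ^+ 2)) <=
  \int[lebesgue_measure]_(t in circle) (W t * normc p.[expi t] ^+ 2) + fine L.
Proof.
move=> p0 p1; have [W0 Wm /andP[_ Wf] Wl] := W_szego.
have [r pE] := closed_field_poly_normal p.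
have r1 a : a \in r -> normc a < 1.
  move=> ar; apply: p1; rewrite pE rootZ ?lead_coef_eq0 //.
  by rewrite root_prod_XsubC.
(* [E m] is the truncation error, [A m] the constant part of the lower bound, with the 1 from
   [x >= 1 + ln x], and [h m] the part of mean zero. *)
pose E m := \sum_(a <- r) log_error m (normc a).
pose A m := 1 + (ln (normc (lead_coef p) ^+ 2) - E m).
pose h m t := - 2 * \sum_(a <- r) log_taylor m (a * Num.conj (expi t)).
have h0 m : zero_mean (h m).
  by apply/zero_meanZ/zero_mean_sum => a; exact: zero_mean_log_taylor.
have Wpi : lebesgue_measure.-integrable circle
    (EFin \o (fun t => W t * normc p.[expi t] ^+ 2)).
  apply: weight_mul_integrable => //.
  have [cr ci] := parts_continuous_horner p (@parts_continuous_expi R).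
  move=> t; under eq_fun do rewrite normc_sqr.
  by apply: cvgD; apply: cvgM; solve [exact: cr|exact: ci].
have main m : 2 * pi * A m <=
    \int[lebesgue_measure]_(t in circle) (W t * normc p.[expi t] ^+ 2) + fine L.
  have [Ai <-] := zero_mean_cst (A m) (h0 m).
  have Lfin : L \is a fin_num.
    by rewrite ge0_fin_numE // integral_ge0.
  have Ifin := integrable_fin_num mcircle Wpi.
  rewrite -lee_fin EFinD (fineK Lfin) /Rintegral (fineK Ifin).
  rewrite (fineK (integrable_fin_num mcircle Ai)).
  rewrite -integralD //; last exact: abs_lne_integrable.
  apply: le_integral => //.
    exact: (integrableD mcircle Wpi abs_lne_integrable).
  move=> t; rewrite inE => tD.
  suff : ((A m + h m t)%:E <=
    (W t * normc p.[expi t] ^+ 2)%:E + `|lne (W t)%:E|)%E by [].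
  have [N0 Nge] := ln_normc_poly_ge m t pE p0 r1.
  (* Where [W t <= 0], [|lne (W t)|] is [+oo] and the inequality is trivial. *)
  have [Wt|Wt] := ltP 0 (W t); last by rewrite (@le0_lneNy _ (W t)%:E) // leey.
  rewrite lne_EFin // -EFinD lee_fin.
  have := expR_ge1Dx (ln (W t * normc p.[expi t] ^+ 2)).
  rewrite lnK ?posrE; last exact: mulr_gt0.
  have -> : ln (W t * normc p.[expi t] ^+ 2) =
      ln (W t) + ln (normc p.[expi t] ^+ 2) by rewrite lnM ?posrE.
  have := ler_norm (- ln (W t)); rewrite normrN.
  rewrite /A /h /E; lra.
(* The left side of [main] depends on [m] only through [E m], which tends to 0. *)
have Elim : 2 * pi * A m @[m --> \oo] -->
    2 * pi * (1 + (ln (normc (lead_coef p) ^+ 2) - 0)).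
  apply: cvgM; first exact: cvg_cst.
  apply: cvgD; first exact: cvg_cst.
  apply: cvgB; first exact: cvg_cst.
  exact: sum_log_error_cvg0.
rewrite -[ln _]subr0.
apply: (cvgr_to_le Elim); near=> m; exact: main.
Unshelve. all: by end_near.
Qed.

End LogWeight.

(** * Uniform bounds off the circle *)

Section Majorants.
Variable R : realType.
Implicit Types (x a b : nat -> R) (r : R).

(** Once [a n <= q < 1] and [b n] is small, iterating from rank [N] leaves [eps / 2] plus the
    geometric term [q ^+ k * x N]. *)
Lemma contracting_cvg0 x a b r : (forall n, 0 <= x n) ->
  (forall n, x n.+1 <= a n * x n + b n) -> 0 <= r < 1 ->
  a n @[n --> \oo] --> r -> b n @[n --> \oo] --> 0 -> x n @[n --> \oo] --> 0.
Proof.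
move=> x0 xS /andP[r0 r1] ar b0; apply/cvgr0Pnorm_le => eps eps0.
pose q := (1 + r) / 2; have qr : r < q by rewrite /q; lra.
have q0 : 0 <= q by lra.
have q1 : q < 1 by rewrite /q; lra.
(* This threshold for [b n] makes [eps / 2] the fixed point of the majorizing affine map of slope
   [q]. *)
have d0 : 0 < eps / 2 * (1 - q) by rewrite mulr_gt0 //; lra.
have [N _ NP] : \forall n \near \oo, a n <= q /\ b n <= eps / 2 * (1 - q).
  near=> n; split; near: n; first exact: cvgr_le ar _ qr.
  exact: cvgr_le b0 _ d0.
have bound k : x (k + N)%N <= eps / 2 + q ^+ k * x N.
  elim: k => [|k IH]; first by rewrite expr0 mul1r add0n; have := x0 N; lra.
  have [aq bq] := NP (k + N)%N (leq_addl _ _).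
  rewrite addSn (le_trans (xS _)) // (le_trans (lerD (ler_wpM2r (x0 _) aq) bq)) //.
  have := ler_wpM2l q0 IH; rewrite exprS; lra.
have qN : q ^+ k * x N @[k --> \oo] --> 0.
  rewrite -[X in _ --> X](mul0r (x N)); apply: cvgM; last exact: cvg_cst.
  by apply: cvg_expr; rewrite ger0_norm.
have e20 : 0 < eps / 2 by lra.
have [M _ MP] := cvgr_le _ qN _ e20.
exists (M + N)%N => // n /= Mn; rewrite ger0_norm //.
have Nn : (N <= n)%N := leq_trans (leq_addl _ _) Mn.
have := bound (n - N)%N; rewrite subnK // => /le_trans; apply.
have := MP (n - N)%N; rewrite /= leq_subRL // addnC => /(_ Mn); lra.
Unshelve. all: by end_near.
Qed.

Variables (e : nat -> R) (r : R).

(** Worst case of [blaschke_step]: the components bound [|B| / |A|] and [|W| / |A|^2]. They start at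
    [(1, 0)] because [phi 0] is a constant equal to its reversal. *)
Fixpoint majorants n : R * R :=
  if n is m.+1 then
    (((r * (majorants m).1 + e m) / (1 - e m)),
     (((majorants m).1 + r * (majorants m).2) / (1 - e m) ^+ 2))
  else (1, 0).

Hypothesis e01 : forall n, 0 <= e n < 1.
Hypothesis r01 : 0 <= r < 1.
Hypothesis e_cvg0 : e n @[n --> \oo] --> 0.

Lemma majorants_ge0 n : 0 <= (majorants n).1 /\ 0 <= (majorants n).2.
Proof.
have /andP[r0 r1] := r01.
elim: n => [|n [x0 y0]] /=; first by rewrite ler01 lexx.
have /andP[e0 e1] := e01 n.
have e1' : 0 <= 1 - e n by lra.
by split; rewrite divr_ge0 // ?exprn_ge0 // addr_ge0 ?mulr_ge0.
Qed.

Let inv_cvg1 : (1 - e n)^-1 @[n --> \oo] --> (1 : R).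
Proof.
rewrite -[X in _ --> X]invr1; apply: cvgV => //.
by rewrite -[X in _ --> X]subr0; apply: cvgB => //; exact: cvg_cst.
Qed.

Lemma majorant1_cvg0 : (majorants n).1 @[n --> \oo] --> 0.
Proof.
apply: (@contracting_cvg0 _ (fun n => r * (1 - e n)^-1)
  (fun n => e n * (1 - e n)^-1) r) => //.
- by move=> n; have [] := majorants_ge0 n.
- by move=> n /=; rewrite mulrDl mulrAC.
- by rewrite -[X in _ --> X]mulr1; apply: cvgM => //; exact: cvg_cst.
- by rewrite -[X in _ --> X](mul0r 1); apply: cvgM.
Qed.

(** The contraction factor again tends to [r], and the inhomogeneous term is driven by the first
    majorant, which tends to 0. *)
Lemma majorant2_cvg0 : (majorants n).2 @[n --> \oo] --> 0.
Proof.
have inv2 : ((1 - e n)^-1 * (1 - e n)^-1) @[n --> \oo] --> (1 : R).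
  by rewrite -[X in _ --> X]mulr1; apply: cvgM.
apply: (@contracting_cvg0 _ (fun n => r * ((1 - e n)^-1 * (1 - e n)^-1))
  (fun n => (majorants n).1 * ((1 - e n)^-1 * (1 - e n)^-1)) r) => //.
- by move=> n; have [] := majorants_ge0 n.
- by move=> n /=; rewrite expr2 invfM mulrDl [leLHS]addrC mulrAC.
- by rewrite -[X in _ --> X]mulr1; apply: cvgM => //; exact: cvg_cst.
- by rewrite -[X in _ --> X](mul0r 1); apply: cvgM => //; exact: majorant1_cvg0.
Qed.

End Majorants.

(** * Leading coefficients and decay of the recursion coefficients *)

Section OPUC.
Variables (R : realType) (W : R -> R) (phi : nat -> {poly R[i]}).
Hypothesis W_szego : szego_class W.
Hypothesis phi_OPUC : is_OPUC W phi.

Let B := szego_form W.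

Let B_form : toeplitz_form B.
Proof.
have [W0 Wm /andP[_ Wf] _] := W_szego; exact: szego_form_toeplitz.
Qed.

Let size_phi m : size (phi m) = m.+1. Proof. by have [/(_ m)[]] := phi_OPUC. Qed.
Let lead_phi m : 0 < lead_coef (phi m).
Proof. by have [/(_ m)[]] := phi_OPUC. Qed.
Let B_phi m k : B (phi m) (phi k) = (m == k)%:R.
Proof. by have [_] := phi_OPUC; exact. Qed.

Let kappa n : R := normc (lead_coef (phi n)).

Lemma kappaE n : (kappa n)%:C = lead_coef (phi n).
Proof. by rewrite /kappa -normE gtr0_norm. Qed.

Lemma kappa_gt0 n : 0 < kappa n.
Proof. by rewrite -ltcR kappaE. Qed.

Lemma weight_normc_phi n :
  \int[lebesgue_measure]_(t in `[- pi, pi]) (W t * normc (phi n).[expi t] ^+ 2) =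
  2 * pi.
Proof.
have pi2 : 2 * pi != 0 :> R by rewrite mulf_neq0 // gt_eqF // pi_gt0.
have /(congr1 (fun z => complex.Re ((2 * pi)%:C * z))) := B_phi n n.
rewrite eqxx /B /szego_form mulrA -rmorphM divff // mul1r mulr1.
rewrite [RHS]/= => <-; apply: eq_Rintegral => t _.
by rewrite -mulrA -normCK normE -rmorphXn /= mul0r subr0.
Qed.

(** The roots of [phi n] lie in the open disk, so [ln_lead_coef_le] applies; by orthonormality its
    integral is [2 pi], which cancels and leaves [ln (kappa n ^+ 2) <= fine L / (2 * pi)]. *)
Lemma kappa_bounded : has_ubound (range kappa).
Proof.
pose L := (\int[lebesgue_measure]_(t in `[(- pi)%R, pi]) `|lne (W t)%:E|)%E.
(* For [E > 0], [k ^+ 2 <= E] implies [k <= 1 + E], which avoids a square root. *)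
exists (1 + expR (fine L / (2 * pi))) => _ [n _ <-].
have pi2 : 0 < 2 * pi :> R by rewrite mulr_gt0 // pi_gt0.
have phi0 : phi n != 0 by rewrite -size_poly_gt0 size_phi.
have root1 a : root (phi n) a -> normc a < 1.
  by move=> /(phi_root_lt1 B_form size_phi lead_phi B_phi); rewrite normE -ltcR.
have := ln_lead_coef_le W_szego phi0 root1.
rewrite weight_normc_phi mulrDr mulr1 lerD2l -/L -/(kappa n).
rewrite mulrC -ler_pdivlMr // -ler_expR lnK ?posrE ?exprn_gt0 ?kappa_gt0 //.
have := expR_gt0 (fine L / (2 * pi)); have := kappa_gt0 n.
rewrite expr2; nra.
Qed.

(** [c n] is [conj(alpha_n)] for the Verblunsky coefficient [alpha_n] in the usual convention. *)
Definition verblunsky_spec (c : nat -> R[i]) := forall n,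
  let s := lead_coef (phi n) / lead_coef (phi n.+1) in
  [/\ s ^+ 2 + `|c n| ^+ 2 = 1,
    s *: phi n.+1 = 'X * phi n - c n *: reversed n (phi n) &
    s *: reversed n.+1 (phi n.+1) =
      reversed n (phi n) - (c n)^* *: ('X * phi n)].

Lemma verblunsky_exists : exists c, verblunsky_spec c.
Proof.
have recursion n := szego_recursion B_form size_phi lead_phi B_phi n.
by have [c cP] := choice recursion; exists c.
Qed.

Variable c : nat -> R[i].
Hypothesis cP : verblunsky_spec c.

Let e n := normc (c n).

Lemma kappa_ratio n : (kappa n / kappa n.+1) ^+ 2 + e n ^+ 2 = 1.
Proof.
apply: complexI; have [+ _ _] := cP n.
by rewrite -!kappaE normE rmorphD !rmorphXn /= rmorphM /= fmorphV.
Qed.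

Lemma verblunsky_lt1 n : 0 <= e n < 1.
Proof.
rewrite normc_ge0 /= -(@expr_lt1 _ 2) ?normc_ge0 //.
have := kappa_ratio n.
have : 0 < (kappa n / kappa n.+1) ^+ 2 by rewrite exprn_gt0 ?divr_gt0 ?kappa_gt0.
lra.
Qed.

(** The limit of [kappa] is positive, so consecutive ratios tend to 1 and [kappa_ratio] forces [e n]
    to 0. *)
Lemma verblunsky_cvg0 : e n @[n --> \oo] --> 0.
Proof.
have nd : nondecreasing_seq kappa.
  apply/nondecreasing_seqP => n.
  rewrite -[leRHS]mul1r -ler_pdivrMr ?kappa_gt0 //.
  rewrite -(@expr_le1 _ 2) // ?divr_ge0 ?(ltW (kappa_gt0 _)) //.
  by rewrite -(kappa_ratio n) lerDl sqr_ge0.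
have kcvg : cvgn kappa := nondecreasing_is_cvgn nd kappa_bounded.
set l := limn kappa in kcvg.
have l0 : 0 < l.
  by rewrite (lt_le_trans (kappa_gt0 0)) //; exact: nondecreasing_cvgn_le.
have kS : kappa n.+1 @[n --> \oo] --> l by rewrite cvg_shiftS.
have ratio : (1 - (kappa n / kappa n.+1) ^+ 2) @[n --> \oo] --> 0.
  rewrite -[X in _ --> X](subrr (1 : R)); apply: cvgB; first exact: cvg_cst.
  rewrite -(expr1n _ 2) -(divff (lt0r_neq0 l0)).
  by apply: cvgM; apply: cvgM => //; apply: cvgV => //; rewrite gt_eqF.
have -> : e = (fun n => Num.sqrt (1 - (kappa n / kappa n.+1) ^+ 2)).
  apply/funext => n; rewrite -(kappa_ratio n) addrC addKr.
  by rewrite sqrtr_sqr ger0_norm // normc_ge0.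
rewrite -sqrtr0; apply: continuous_cvg => //; exact: sqrt_continuous.
Qed.

(** * Estimates at a fixed point *)

Section Point.
Variable z : R[i].

Let s n := lead_coef (phi n) / lead_coef (phi n.+1).
Let u n := (phi n).[z].
Let v n := (reversed n (phi n)).[z].
Let u' n := (phi n)^`().[z].
Let v' n := (reversed n (phi n))^`().[z].
Let wronskian n := u' n * v n - u n * v' n.

Let s_gt0 n : 0 < s n. Proof. by rewrite divr_gt0. Qed.
Let s_c n : s n ^+ 2 + `|c n| ^+ 2 = 1. Proof. by have [] := cP n. Qed.
Let uE n : s n * u n.+1 = z * u n - c n * v n.
Proof.
have [_ /(congr1 (fun p => p.[z])) + _] := cP n.
by rewrite !hornerE.
Qed.
Let vE n : s n * v n.+1 = v n - Num.conj (c n) * (z * u n).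
Proof.
have [_ _ /(congr1 (fun p => p.[z]))] := cP n.
by rewrite !hornerE.
Qed.
Let u'E n : s n * u' n.+1 = u n + z * u' n - c n * v' n.
Proof.
have [_ /(congr1 (fun p => p^`().[z])) + _] := cP n.
by rewrite !poly.derivE !hornerE ?mul1r.
Qed.
Let v'E n : s n * v' n.+1 = v' n - Num.conj (c n) * (u n + z * u' n).
Proof.
have [_ _ /(congr1 (fun p => p^`().[z]))] := cP n.
by rewrite !poly.derivE !hornerE ?mul1r.
Qed.

Let phi0E : phi 0%N = (kappa 0)%:C%:P.
Proof.
by rewrite kappaE lead_coefE size_phi; apply: size1_polyC; rewrite size_phi.
Qed.

Let uv0 : v 0%N = u 0%N.
Proof.
by rewrite /v /u /reversed phi0E horner_poly big_ord1 expr0 mulr1 coefC conjC_real hornerC.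
Qed.
Let u'0 : u' 0%N = 0.
Proof. by rewrite /u' phi0E derivC horner0. Qed.
Let v'0 : v' 0%N = 0.
Proof.
rewrite /v' [X in X^`()]size1_polyC ?derivC ?horner0 //.
exact: size_reversed.
Qed.
Let u0_neq0 : u 0%N != 0.
Proof. by rewrite /u phi0E hornerC gt_eqF // kappaE. Qed.

Let wronskianS n : wronskian n.+1 = u n * v n + z * wronskian n.
Proof. exact: (wronskian_step s_gt0 s_c uE vE u'E v'E). Qed.

Let cd n := christoffel_darboux00 s_gt0 s_c uE vE uv0 n.

Let s_le1 n : 0 < s n <= 1.
Proof.
rewrite s_gt0 /= -(@expr_le1 _ 2) ?(ltW (s_gt0 n)) // -(s_c n).
by rewrite lerDl exprn_ge0.
Qed.

(** By Christoffel-Darboux, [|v n|^2 - |u n|^2] has the sign of [1 - |z|^2]; that identity starts at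
    index 1, and index 0 is [uv0]. *)
Lemma inside_le n : `|z| < 1 -> `|u n| <= `|v n|.
Proof.
move=> z1; case: n => [|n]; first by rewrite uv0.
rewrite -(@ler_pXn2r _ 2) ?nnegrE // -subr_ge0 !normCK -cd.
by rewrite mulr_ge0 ?(ltW (k00_gt0 _ _)) // subr_ge0 -normCK expr_le1 // ltW.
Qed.

Lemma outside_le n : 1 < `|z| -> `|v n| <= `|u n|.
Proof.
move=> z1; case: n => [|n]; first by rewrite uv0.
rewrite -(@ler_pXn2r _ 2) ?nnegrE // -subr_le0 !normCK -cd.
rewrite mulr_le0_ge0 ?(ltW (k00_gt0 _ _)) // subr_le0 -normCK.
by rewrite exprn_ege1 // ltW.
Qed.

Variable r : R.
Hypothesis r1 : 0 < r < 1.

Let X n := (majorants e r n).1%:C.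
Let Y n := (majorants e r n).2%:C.
Let X0 n : 0 <= X n.
Proof.
have [] := majorants_ge0 verblunsky_lt1 (r := r) _ n; last by rewrite lecR.
by move: r1 => /andP[/ltW -> ->].
Qed.
Let Y0 n : 0 <= Y n.
Proof.
have [] := majorants_ge0 verblunsky_lt1 (r := r) _ n; last by rewrite lecR.
by move: r1 => /andP[/ltW -> ->].
Qed.
Let XS n : X n.+1 = (r%:C * X n + (e n)%:C) / (1 - (e n)%:C).
Proof. by rewrite /X /= rmorphM rmorphD rmorphM fmorphV rmorphB rmorph1. Qed.
Let YS n : Y n.+1 = (X n + r%:C * Y n) / (1 - (e n)%:C) ^+ 2.
Proof.
by rewrite /Y /X /= rmorphM rmorphD rmorphM fmorphV rmorphXn rmorphB rmorph1.
Qed.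
Let e1 n : (e n)%:C < 1.
Proof. by rewrite -[1]/(1%:C) ltcR; have /andP[] := verblunsky_lt1 n. Qed.
Let rC1 : r%:C <= 1.
Proof. by rewrite -[1]/(1%:C) lecR; move: r1 => /andP[_ /ltW]. Qed.

Lemma inside_majorants n : `|z| <= r%:C ->
  `|u n| <= X n * `|v n| /\ `|wronskian n| <= Y n * `|v n| ^+ 2.
Proof.
move=> zr; have z1 : `|z| < 1.
  by rewrite (le_lt_trans zr) // -[1]/(1%:C) ltcR; have /andP[] := r1.
elim: n => [|n [IHu IHw]].
  rewrite /wronskian u'0 v'0 mul0r mulr0 subrr normr0 /X /Y /=.
  by rewrite -/(1%:C) mul1r uv0 mul0r.
rewrite XS YS.
apply: (@blaschke_step _ z (c n) (s n) 1 1 (v n) (u n) (wronskian n)) => //.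
- by rewrite normr1.
- exact: inside_le.
- by rewrite mulr1 vE; ring.
- by rewrite mulr1 uE.
- by rewrite expr1n !mul1r wronskianS mulrC.
Qed.

Lemma outside_majorants n : 1 <= r%:C * `|z| ->
  `|v n| <= X n * `|u n| /\ `|wronskian n| <= Y n * `|u n| ^+ 2.
Proof.
move=> zr; have r0 : 0 < r%:C by rewrite ltcR; have /andP[] := r1.
have z0 : z != 0.
  by apply: contraTneq zr => ->; rewrite normr0 mulr0 lt_geF // ltr01.
have zr' : `|z^-1| <= r%:C.
  by rewrite normfV -div1r ler_pdivrMr // normr_gt0.
have z1 : 1 < `|z|.
  rewrite -(ltr_pM2l r0) mulr1 (lt_le_trans _ zr) //.
  by rewrite -[1]/(1%:C) ltcR; have /andP[] := r1.
elim: n => [|n [IHu IHw]].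
  rewrite /wronskian u'0 v'0 mul0r mulr0 subrr normr0 /X /Y /=.
  by rewrite -/(1%:C) mul1r uv0 mul0r.
rewrite XS YS.
(* Dividing the recursions by [z], and that of the Wronskian by [z^2], puts [z^-1] in the place of
   [z]; hence [t = z^-1] and [k = z^-2]. *)
apply: (@blaschke_step _ z^-1 (Num.conj (c n)) (s n) z^-1 (z^-1 ^+ 2)
   (u n) (v n) (wronskian n)) => //.
- by rewrite normrX exprn_ile1 // (le_trans zr').
- by rewrite norm_conjC.
- by rewrite invr_eq0.
- exact: outside_le.
- by rewrite mulrAC uE conjCK; field.
- by rewrite mulrAC vE; field.
- by rewrite wronskianS; field.
Qed.

(** After dividing through by [|a|^4], the numerator is at most [Y n ^+ 2] and the denominator at
    least [(1 - X n ^+ 2) ^+ 2]. *)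
Let main_bound n (a b : R[i]) : X n < 1 -> a != 0 ->
  `|b| <= X n * `|a| -> `|wronskian n| <= Y n * `|a| ^+ 2 ->
  `|wronskian n| ^+ 2 / (`|a| ^+ 2 - `|b| ^+ 2) ^+ 2 <=
  Y n ^+ 2 / (1 - X n ^+ 2) ^+ 2.
Proof.
move=> X1 A0 BX wY; have NA0 : 0 < `|a| ^+ 2 by rewrite exprn_gt0 // normr_gt0.
have X2 : 0 < 1 - X n ^+ 2 by rewrite subr_gt0 expr_lt1.
have AB : (1 - X n ^+ 2) * `|a| ^+ 2 <= `|a| ^+ 2 - `|b| ^+ 2.
  rewrite mulrBl mul1r lerB // -exprMn lerXn2r // nnegrE mulr_ge0 //.
have AB0 : 0 < `|a| ^+ 2 - `|b| ^+ 2 by rewrite (lt_le_trans _ AB) // mulr_gt0.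
rewrite -!expr_div_n lerXn2r ?nnegrE ?divr_ge0 ?(ltW AB0) ?(ltW X2) //.
rewrite ler_pdivrMr // (le_trans wY) // -mulrA ler_wpM2l //.
by rewrite mulrC ler_pdivlMr // mulrC.
Qed.

Lemma wronskian_bound n : X n.+1 < 1 ->
  `|z| <= r%:C \/ 1 <= r%:C * `|z| ->
  `|z| != 1 ->
  `|wronskian n.+1| ^+ 2 / (`|v n.+1| ^+ 2 - `|u n.+1| ^+ 2) ^+ 2 <=
  Y n.+1 ^+ 2 / (1 - X n.+1 ^+ 2) ^+ 2.
Proof.
move=> X1 zr z1.
(* If the dominating value were zero, the majorants would make the other zero too, contradicting
   [D0]. *)
have D0 : `|v n.+1| ^+ 2 - `|u n.+1| ^+ 2 != 0.
  rewrite !normCK -cd mulf_neq0 ?(gt_eqF (k00_gt0 _ _)) //.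
  rewrite -normCK subr_eq0 eq_sym sqrf_eq1 negb_or z1 gt_eqF //.
  by rewrite (lt_le_trans _ (normr_ge0 _)) // ltrN10.
case: zr => zr.
  have [uX wY] := inside_majorants n.+1 zr.
  apply: main_bound => //; apply: contraNneq D0 => v0.
  by move: uX; rewrite v0 normr0 mulr0 normr_le0 => /eqP ->; rewrite normr0 subrr.
have [uX wY] := outside_majorants n.+1 zr.
(* Outside the disk [u] dominates; the sign of the difference disappears in the square. *)
rewrite -[X in _ / X]sqrrN opprB.
apply: main_bound => //; apply: contraNneq D0 => v0.
by move: uX; rewrite v0 normr0 mulr0 normr_le0 => /eqP ->; rewrite normr0 subrr.
Qed.

(** By [intensity_wronskian] the main terms cancel, leaving the Wronskian quotient over [pi]; the
    bound does not depend on [z]. *)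
Lemma kac_rice_bound n : X n.+1 < 1 ->
  `|z| <= r%:C \/ 1 <= r%:C * `|z| -> `|z| != 1 ->
  `|(K11 phi n z z * K00 phi n z z - `|K01 phi n z z| ^+ 2)
      / (pi%:C * K00 phi n z z ^+ 2) - (limit_intensity z)%:C| <=
  pi%:C^-1 * (Y n.+1 ^+ 2 / (1 - X n.+1 ^+ 2) ^+ 2).
Proof.
move=> X1 zr z1; have bound := wronskian_bound X1 zr z1.
have kr := intensity_wronskian s_gt0 s_c uE vE u'E v'E uv0 u'0 v'0 n u0_neq0 z1.
have piC : 0 < pi%:C :> R[i] by rewrite ltcR pi_gt0.
have -> : (limit_intensity z)%:C = pi%:C^-1 * ((1 - `|z| ^+ 2) ^+ 2)^-1.
  rewrite /limit_intensity div1r invfM rmorphM !fmorphV rmorphXn rmorphB.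
  by rewrite rmorph1 rmorphXn.
rewrite invfM mulrCA kr -mulrBr addrAC subrr sub0r normrM normrN.
rewrite gtr0_norm ?invr_gt0 // ler_wpM2l ?invr_ge0 ?(ltW piC) //.
rewrite ger0_norm //; apply: mulr_ge0; first by rewrite exprn_ge0.
by rewrite invr_ge0 real_exprn_even_ge0 // rpredB // realX // normr_real.
Qed.

End Point.

End OPUC.

(** * Locally uniform convergence of the intensities *)

Section LocalUniformity.
Variables (R : realType) (W : R -> R) (phi : nat -> {poly R[i]}).
Hypothesis W_szego : szego_class W.
Hypothesis phi_OPUC : is_OPUC W phi.
Variable h : nat -> R[i] -> R.
Hypothesis hE : forall n z, (h n z)%:C =
  (K11 phi n z z * K00 phi n z z - `|K01 phi n z z| ^+ 2)
  / (pi%:C * K00 phi n z z ^+ 2).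

(** The majorants depend on [r] and the recursion coefficients but not on [z], so one rank serves
    the whole region. *)
Lemma intensity_cvg_annuli (r eps : R) : 0 < r < 1 -> 0 < eps ->
  \forall n \near \oo, forall z : R[i], normc z <= r \/ 1 <= r * normc z ->
  `|h n z - limit_intensity z| < eps.
Proof.
move=> r01 eps0; have r01' : 0 <= r < 1.
  by have /andP[/ltW -> ->] := r01.
have [c cP] := verblunsky_exists W_szego phi_OPUC.
pose e n := normc (c n).
have e01 := verblunsky_lt1 phi_OPUC cP.
have e0 := verblunsky_cvg0 W_szego phi_OPUC cP.
pose x n := (majorants e r n).1; pose y n := (majorants e r n).2.
have x0 : x n @[n --> \oo] --> 0 := majorant1_cvg0 e01 r01' e0.
have y0 : y n @[n --> \oo] --> 0 := majorant2_cvg0 e01 r01' e0.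
pose delta n := pi^-1 * (y n ^+ 2 / (1 - x n ^+ 2) ^+ 2).
have d0 : delta n @[n --> \oo] --> 0.
  have x2 : (1 - x n ^+ 2) @[n --> \oo] --> (1 : R).
    rewrite -[X in _ --> X]subr0 -[X in _ - X](mul0r 0).
    by apply: cvgB; [exact: cvg_cst|apply: cvgM].
  rewrite -[X in _ --> X](mulr0 pi^-1); apply: cvgM; first exact: cvg_cst.
  rewrite -[X in _ --> X](mul0r (1 : R)); apply: cvgM.
    by rewrite -[X in _ --> X](mul0r 0); apply: cvgM.
  rewrite -[X in _ --> X]invr1; apply: cvgV => //.
  by rewrite -[X in _ --> X](mulr1 1); apply: cvgM.
have dS : delta n.+1 @[n --> \oo] --> 0 by rewrite cvg_shiftS.
have xS : x n.+1 @[n --> \oo] --> 0 by rewrite cvg_shiftS.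
near=> n => z zr.
have xn1 : x n.+1 < 1 by near: n; exact: cvgr_lt xS _ ltr01.
have dn : delta n.+1 < eps by near: n; exact: cvgr_lt dS _ eps0.
apply: le_lt_trans dn.
have z1 : `|z| != 1.
  rewrite normE -[1]/(1%:C) (inj_eq (@complexI R)); apply/eqP => z1.
  by move: zr r01; rewrite z1; lra.
have zrC : `|z| <= r%:C \/ 1 <= r%:C * `|z|.
  by rewrite normE -rmorphM -[1]/(1%:C) !lecR.
have X1 : (x n.+1)%:C < 1 by rewrite -[1]/(1%:C) ltcR.
have := kac_rice_bound phi_OPUC cP r01 X1 zrC z1.
rewrite -hE -rmorphB -lecR => le1.
have normC_real (a : R) : `|a%:C| = `|a|%:C.
  by rewrite normE /= expr0n /= addr0 sqrtr_sqr.
rewrite -normC_real; apply: (le_trans le1).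
by rewrite /delta !(rmorphXn, fmorphV, rmorphM, rmorphB, rmorph1).
Unshelve. all: by end_near.
Qed.

(** Stated jointly in [z'] and [n], the form to which compactness applies. Each point off the circle
    has a neighbourhood inside one region of [intensity_cvg_annuli]. *)
Lemma intensity_near_cvg (z : R[i]) (eps : R) : `|z| != 1 -> 0 < eps ->
  \forall z' \near z & n \near \oo, `|h n z' - limit_intensity z'| < eps.
Proof.
move=> z1 eps0.
have {}z1 : normc z != 1.
  by apply: contraNneq z1 => z1; rewrite normE z1.
have near_dist (d : R) : 0 < d ->
    \forall z' \near z, normc (z - z') < d.
  move=> d0; apply/nbhs_ballP; exists d%:C; first by rewrite /= ltcR.
  by move=> z'; rewrite -ball_normE /= normE ltcR.
have dist (z' : R[i]) : normc z' <= normc z + normc (z - z') /\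
    normc z <= normc z' + normc (z - z').
  rewrite -!lecR !rmorphD /= -!normE; split.
    by rewrite -[X in `|X| <= _](subKr z) (le_trans (ler_normB _ _)).
  by rewrite -[X in `|X| <= _](subrK z') addrC ler_normD.
have annulus r : 0 < r < 1 ->
    (\forall z' \near z, normc z' <= r \/ 1 <= r * normc z') ->
    \forall z' \near z & n \near \oo, `|h n z' - limit_intensity z'| < eps.
  move=> r01 zr; exists ([set z' | normc z' <= r \/ 1 <= r * normc z'],
    [set n | forall z' : R[i], normc z' <= r \/ 1 <= r * normc z' ->
       `|h n z' - limit_intensity z'| < eps]).
    by split => //; exact: intensity_cvg_annuli.
  by move=> [z' n] /= [z'r]; exact.
have z0 := normc_ge0 z.
have [zlt|zge] := ltP (normc z) 1.
  (* The midpoint of [|z|] and 1 leaves room for a ball of radius [(1 - |z|) / 2] about [z]. *)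
  apply: (annulus ((1 + normc z) / 2)); first by lra.
  apply: filterS (near_dist ((1 - normc z) / 2) _); last by lra.
  by move=> z' zz'; have [le1 _] := dist z'; left; lra.
have zgt : 1 < normc z by rewrite lt_neqAle eq_sym z1.
have m0 : 0 < (1 + normc z) / 2 by lra.
(* The region begins at the midpoint of 1 and [|z|], so [r] is the inverse of that midpoint. *)
apply: (annulus ((1 + normc z) / 2)^-1).
  by rewrite invr_gt0 m0 invf_lt1 //; lra.
apply: filterS (near_dist ((normc z - 1) / 2) _); last by lra.
move=> z' zz'; have [_ le2] := dist z'; right.
by rewrite mulrC ler_pdivlMr // mul1r; lra.
Qed.

End LocalUniformity.

Theorem theorem2 (R : realType) (W : R -> R)
    (W_periodic : periodic W (pi *+ 2))
    (W_even : forall t, W (- t) = W t)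
    (W_szego : szego_class W)
    (phi : nat -> {poly R[i]}) (phi_OPUC : is_OPUC W phi)
    (d : measure_display) (T : measurableType d) (P : probability T R)
    (alpha beta : nat -> {RV P >-> R})
    (coef_normal : iid_standard_normal alpha beta)
    (h : nat -> R[i] -> R)
    (h_intensity : forall n, is_intensity alpha beta phi n (h n)) :
  (forall z : R[i], `|z| != 1 ->
     h n z @[n --> \oo] --> limit_intensity z) /\
  (forall K : set R[i], compact K -> K `<=` [set z | `|z| != 1] ->
     {uniform K, h @ \oo --> @limit_intensity R}).
Proof.
have hE n z : (h n z)%:C =
    (K11 phi n z z * K00 phi n z z - `|K01 phi n z z| ^+ 2)
    / (pi%:C * K00 phi n z z ^+ 2) by have [_] := h_intensity n; exact.
have near_cvg := intensity_near_cvg W_szego phi_OPUC hE.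
split=> [z z1|K cK K1].
  apply/cvgrPdistC_lt => eps eps0.
  have [[A N] [/= nA nN] ANh] := near_cvg z eps z1 eps0.
  apply: filterS nN => n Nn; apply: (ANh (z, n)); split => //=.
  exact: nbhs_singleton.
move=> Q /uniform_nbhs [E [entE EQ]].
have [eps /= eps0 epsE] := entE.
have cover : \forall n \near \oo,
    K `<=` [set z | `|h n z - limit_intensity z| < eps].
  (* Compactness merges the ranks valid near each point into one valid on all of [K]. *)
  apply: (proj1 (compact_near_coveringP K) cK) => z Kz.
  exact: near_cvg (K1 z Kz) eps0.
apply: filterS cover => n hn; apply: EQ => z Kz /=.
apply: epsE => /=.
by rewrite distrC; exact: hn.
Qed.
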